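(* Let $d\ge1$ and let $(G_i)$ be a Benjamini--Schramm convergent sequence of finite vertex-transitive bipartite $d$-regular graphs. Then the sequence $$\lambda_{G_i}(1)=\frac{\ln \mathrm{pm}(G_i)}{v(G_i)}$$ is convergent, where $\mathrm{pm}(G)$ is the number of perfect matchings and $v(G)$ the number of vertices of $G$. Furthermore, if $(G_i)$ Benjamini--Schramm converges to a random rooted graph $L$, then $$\lim_{i\to\infty}\lambda_{G_i}(1)=\lambda_L(1).$$
   Context: Graphs $G_i$ are finite and simple. A graph is vertex-transitive if for all vertices $u,v$ there is an automorphism $\phi$ with $\phi(u)=v$. Benjamini--Schramm convergence. A random rooted graph $L$ is a probability distribution on (possibly infinite) rooted graphs. For a finite rooted graph $\alpha$ and a positive integer $r$, $\mathbb P(L,\alpha,r)$ is the probability that the $r$-ball centered at the root of a rooted graph chosen from $L$ is isomorphic (as a rooted graph) to $\alpha$; for a finite graph $G$, $\mathbb P(G,\alpha,r)$ is the probability that the $r$-ball centered at a uniform random vertex of $G$ is isomorphic to $\alpha$. A sequence $(G_i)$ of finite graphs of uniformly bounded degree is Benjamini--Schramm convergent if $\mathbb P(G_i,\alpha,r)$ converges for all $\alpha$ and $r$; it Benjamini--Schramm converges to $L$ if $\mathbb P(G_i,\alpha,r)\to\mathbb P(L,\alpha,r)$ for all $\alpha,r$. Entropy function of a finite graph. A $k$-matching is a set of $k$ pairwise vertex-disjoint edges; $m_k(G)$ is the number of $k$-matchings ($m_0(G)=1$). For $v(G)=2n$ let $M(G,t)=\sum_{k=0}^n m_k(G)t^k$,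 $t\ge 0$, and $$p(G,t)=\frac{t\,M'(G,t)}{n\,M(G,t)},\qquad F(G,t)=\frac{\ln M(G,t)}{v(G)}-\frac12\,p(G,t)\ln t$$ (with $F(G,0)=0$). Let $p^*(G)=2\nu(G)/v(G)$, where $\nu(G)$ is the size of a largest matching. The function $t\mapsto p(G,t)$ is a strictly increasing bijection $[0,\infty)\to[0,p^* )$, with inverse $t(G,p)$. Put $\lambda_G(p)=F(G,t(G,p))$ for $0\le p<p^*$ and $\lambda_G(p^* )=\lim_{p\nearrow p^*}\lambda_G(p)$ (the limit exists). If $G$ has a perfect matching (as every $d$-regular bipartite graph with $d\ge 1$ does) then $p^*=1$ and $\lambda_G(1)=\ln \mathrm{pm}(G)/v(G)$. Entropy function of a limit. If a random rooted graph $L$ is the Benjamini--Schramm limit of uniformly bounded degree finite graphs $(G_i)$ all having perfect matchings, then $\lambda_L(p)=\lim_{i\to\infty}\lambda_{G_i}(p)$ for $0\le p<1$ (this limit exists and does not depend on the chosen sequence), and $\lambda_L(1)=\lim_{p\nearrow1}\lambda_L(p)$. *)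

(* Defs.v *)
From HB Require Import structures.
From mathcomp Require Import all_boot all_order all_fingroup all_algebra.
From mathcomp Require Import all_classical all_reals all_analysis.
Import Order.TTheory GRing.Theory Num.Theory.
Import numFieldNormedType.Exports.

Set Implicit Arguments.
Unset Strict Implicit.
Unset Printing Implicit Defensive.

Local Open Scope ring_scope.

(* Non-emptiness is required because a uniform random vertex, and division by
   the number of vertices, must make sense. *)
Record sgraph := SGraph {
  svertex :> finType;
  sadj : rel svertex;
  sadj_sym : symmetric sadj;
  sadj_irr : irreflexive sadj;
  svertex_gt0 : (0 < #|svertex|)%N }.

Definition regular_graph (G : sgraph) (d : nat) : Prop :=
  forall x : G, #|[set y | sadj x y]| = d.

Definition bipartite (G : sgraph) : Prop :=
  exists A : {set G}, forall x y : G, sadj x y -> (x \in A) != (y \in A).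

Definition automorphism (G : sgraph) (phi : {perm G}) : Prop :=
  forall x y : G, sadj (phi x) (phi y) = sadj x y.

Definition vertex_transitive (G : sgraph) : Prop :=
  forall u v : G, exists2 phi : {perm G}, automorphism phi & phi u = v.

Section Matchings.
Variable G : sgraph.

Definition edges : {set {set G}} :=
  [set e : {set G} | [exists x : G, exists y : G,
     sadj x y && (e == [set x; y])]].

Definition matching (S : {set {set G}}) : bool :=
  (S \subset edges) && finset.trivIset S.

Definition nb_matchings (k : nat) : nat :=
  #|[set S : {set {set G}} | matching S & #|S| == k]|.

Definition matching_number : nat := \max_(S : {set {set G}} | matching S) #|S|.

Definition perfect_matching (S : {set {set G}}) : bool :=
  matching S && (finset.cover S == [set: G]).

Definition nb_perfect_matchings : nat :=
  #|[set S : {set {set G}} | perfect_matching S]|.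

End Matchings.

Local Open Scope classical_set_scope.

Section Entropy.
Variables (R : realType) (G : sgraph).

Definition matching_gen : {poly R} :=
  \poly_(k < (#|G|./2).+1) (nb_matchings G k)%:R.

(* #|G|%:R / 2 is the n of v(G) = 2n. *)
Definition matching_density (t : R) : R :=
  t * (matching_gen^`()).[t] / (#|G|%:R / 2 * matching_gen.[t]).

Definition entropy_activity (t : R) : R :=
  if t == 0 then 0
  else ln matching_gen.[t] / #|G|%:R - 2^-1 * matching_density t * ln t.

Definition max_matching_density : R := (2 * matching_number G)%:R / #|G|%:R.

Definition activity (p : R) : R :=
  get [set t : R | 0 <= t /\ matching_density t = p].

(* Meaningful for 0 <= p <= max_matching_density. *)
Definition entropy (p : R) : R :=
  if p < max_matching_density then entropy_activity (activity p)
  else lim (entropy_activity (activity q) @[q --> max_matching_density^'-]).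

End Entropy.

(* Rooted graphs, possibly infinite and possibly disconnected; only the
   component of the root matters for what follows. *)
Record rgraph := RGraph {
  rvertex : Type;
  radj : rel rvertex;
  radj_sym : symmetric radj;
  radj_irr : irreflexive radj;
  rroot : rvertex }.

Definition rooted_iso (G H : rgraph) : Prop :=
  exists f : rvertex G -> rvertex H,
    [/\ bijective f, f (rroot G) = rroot H
      & forall x y, radj (f x) (f y) = radj x y].

Section Ball.
Variables (G : rgraph) (r : nat).

Definition ball_vertices : set (rvertex G) :=
  [set x | exists s : seq (rvertex G),
     [/\ (size s <= r)%N, path (@radj G) (rroot G) s & last (rroot G) s = x]].

Definition ball_adj : rel ball_vertices := fun x y => radj (val x) (val y).

Lemma ball_adj_sym : symmetric ball_adj.
Proof. by move=> x y; exact: radj_sym. Qed.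

Lemma ball_adj_irr : irreflexive ball_adj.
Proof. by move=> x; exact: radj_irr. Qed.

Lemma root_in_ball : rroot G \in ball_vertices.
Proof. by apply/mem_set; exists [::]. Qed.

Definition rball : rgraph :=
  RGraph ball_adj_sym ball_adj_irr (exist _ (rroot G) root_in_ball).

End Ball.

Definition root_at (G : sgraph) (v : G) : rgraph :=
  RGraph (@sadj_sym G) (@sadj_irr G) v.

Record rooted_sgraph := RootedSGraph {
  rsg_graph : sgraph;
  rsg_root : rsg_graph }.

Definition rgraph_of_sgraph (a : rooted_sgraph) : rgraph := root_at (rsg_root a).

(* A connected locally finite graph is countable, so up to isomorphism its
   vertices are natural numbers. *)
Record crgraph := CRGraph {
  cvertex : pred nat;
  cadj : rel {n : nat | cvertex n};
  cadj_sym : symmetric cadj;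
  cadj_irr : irreflexive cadj;
  croot : {n : nat | cvertex n} }.

Definition rgraph_of_crgraph (G : crgraph) : rgraph :=
  RGraph (@cadj_sym G) (@cadj_irr G) (croot G).

Definition ball_event (a : rooted_sgraph) (r : nat) : set crgraph :=
  [set G | rooted_iso (rball (rgraph_of_crgraph G) r) (rgraph_of_sgraph a)].

HB.instance Definition _ := gen_eqMixin crgraph.
HB.instance Definition _ := gen_choiceMixin crgraph.

Definition single_vertex_crgraph : crgraph :=
  @CRGraph (pred1 0%N) (fun _ _ => false) (fun _ _ => erefl) (fun _ => erefl)
    (exist _ 0%N (eqxx 0%N)).

HB.instance Definition _ := isPointed.Build crgraph single_vertex_crgraph.

Definition ball_events : set (set crgraph) :=
  [set A | exists a r, (0 < r)%N /\ A = ball_event a r].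

(* The sigma-algebra generated by the ball events: isomorphic rooted graphs are
   never separated by it, so this is a law on isomorphism classes. *)
Definition random_rgraph (R : realType) :=
  probability (g_sigma_algebraType ball_events) R.

Definition ball_prob (R : realType) (L : random_rgraph R) (a : rooted_sgraph)
    (r : nat) : R :=
  fine (L (ball_event a r)).

Definition ball_freq (R : realType) (G : sgraph) (a : rooted_sgraph)
    (r : nat) : R :=
  #|[set v : G |
     `[< rooted_iso (rball (root_at v) r) (rgraph_of_sgraph a) >]]%SET|%:R
  / #|G|%:R.

Definition bounded_degree (Gs : nat -> sgraph) : Prop :=
  exists D : nat, forall i (x : Gs i), (#|[set y | sadj x y]%SET| <= D)%N.

Definition BS_convergent (R : realType) (Gs : nat -> sgraph) : Prop :=
  bounded_degree Gs /\
  forall a r, (0 < r)%N -> cvgn (fun i => ball_freq R (Gs i) a r).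

Definition BS_converges_to (R : realType) (Gs : nat -> sgraph)
    (L : random_rgraph R) : Prop :=
  bounded_degree Gs /\
  forall a r, (0 < r)%N ->
    ball_freq R (Gs i) a r @[i --> \oo] --> ball_prob L a r.

Section LimitEntropy.
Variables (R : realType) (L : random_rgraph R).

(* The value for p < 1 is read off any sequence of graphs with perfect matchings
   that converges to L; it does not depend on the sequence. *)
Definition limit_entropy_lt1 (p : R) : R :=
  get [set l : R | exists Gs : nat -> sgraph,
    [/\ BS_converges_to Gs L,
        forall i, exists S, @perfect_matching (Gs i) S
      & entropy (Gs i) p @[i --> \oo] --> l]].

(* Meaningful for 0 <= p <= 1. *)
Definition limit_entropy (p : R) : R :=
  if p < 1 then limit_entropy_lt1 p
  else lim (limit_entropy_lt1 q @[q --> 1^'-]).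

End LimitEntropy.

(* Main.v *)
Require Import Defs.
From mathcomp Require Import all_boot all_order all_fingroup all_algebra.
From mathcomp Require Import all_classical all_reals all_analysis.
From mathcomp Require Import fintype finset lra.
Import Order.TTheory GRing.Theory Num.Theory.
Import numFieldNormedType.Exports.
Local Open Scope ring_scope.

Set Implicit Arguments.
Unset Strict Implicit.
Unset Printing Implicit Defensive.

(** Let [p(t)] be the density of the vertices covered by a random matching drawn
    with weight [t] per edge, and [q(t) = 1 - p(t)].  In a bipartite graph, for
    [u] and [v] on opposite sides, [M(G-u) M(G-v) <= M(G) M(G-u-v)], so that in a
    vertex-transitive [d]-regular one [q(t)^2 t d <= 1].  This bound is uniform in
    the graph; it gives a perfect matching, and, because [ln M / v(G)] has
    derivative [p / 2] in [ln t], it controls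
    [ln M(G,t) / v(G) - (ln t) / 2 - ln pm(G) / v(G)] by [2 / sqrt t], so the entropy
    functions are equicontinuous at [p = 1].

    For fixed [t], [q(t)] is the average over [u] of the ratio [M(G-u) / M(G)],
    and these ratios satisfy a recursion along self-avoiding walks which contracts
    relative errors by [t D / (1 + t D)] when degrees are at most [D].  Hence the
    ratio at [u] is determined by the ball around [u] up to an error exponentially
    small in the radius, and graphs with close ball frequencies have close [q] and
    [ln M / v(G)], uniformly on [[0, T]].  Entropies then converge for [p < 1], since
    [entropy p] is the minimum over [t] of [ln M(G,t) / v(G) - (p / 2) ln t]. *)

(** * Matching polynomials of induced subgraphs *)

Section MatchingSum.
Variables (R : realType) (G : sgraph).
Implicit Types (t : R) (S : {set G}) (m : {set {set G}}) (u v w : G).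

(** The matching polynomial of [G - S] at [t]. Matchings of the induced subgraph are taken as
    matchings of [G] whose cover avoids [S], so that all deletions live on one vertex type. *)
Definition matching_sum t S : R :=
  \sum_(m | matching m && [disjoint cover m & S]) t ^+ #|m|.

Lemma edge_card (e : {set G}) : e \in edges G -> #|e| = 2.
Proof.
rewrite inE => /existsP[x /existsP[y /andP[xy /eqP->]]].
by rewrite cards2; case: eqP xy => // ->; rewrite sadj_irr.
Qed.

Lemma mem_edges u w : ([set u; w] \in edges G) = sadj u w.
Proof.
rewrite inE; apply/existsP/idP => [[x /existsP[y /andP[xy /eqP e]]]|uw]; last first.
  by exists u; apply/existsP; exists w; rewrite uw eqxx.
have c2 := @edge_card [set x; y].
have xyE : [set x; y] \in edges G.
  by rewrite inE; apply/existsP; exists x; apply/existsP; exists y; rewrite xy eqxx.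
have uwN : u != w.
  by move: (c2 xyE); rewrite -e cards2; case: (u != w).
have : u \in [set x; y] by rewrite -e !inE eqxx.
have : w \in [set x; y] by rewrite -e !inE eqxx orbT.
rewrite !inE => /orP[]/eqP we /orP[]/eqP ue; rewrite we ue ?eqxx in uwN *; rewrite // in uwN.
by rewrite sadj_sym.
Qed.

Lemma matchingP m : reflect
  ((forall e, e \in m -> e \in edges G) /\
   {in m &, forall A B : {set G}, A != B -> [disjoint A & B]}) (matching m).
Proof.
apply: (iffP andP) => [[/subsetP h1 /trivIsetP h2]|[h1 h2]]; split=> //.
  exact/subsetP.
exact/trivIsetP.
Qed.

Lemma matching_set0 : matching (set0 : {set {set G}}).
Proof.
by rewrite /matching sub0set; apply/trivIsetP => A B; rewrite inE.
Qed.

Lemma card_cover_matching m : matching m -> #|cover m| = (2 * #|m|)%N.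
Proof.
move=> /andP[/subsetP hE]; rewrite /trivIset => /eqP <-.
rewrite (eq_bigr (fun=> 2%N)) => [|e /hE /edge_card //].
by rewrite sum_nat_const mulnC.
Qed.

Lemma matching_card_le m : matching m -> (2 * #|m| <= #|G|)%N.
Proof. by move=> mm; rewrite -card_cover_matching ?max_card. Qed.

Lemma matching_sub (m m' : {set {set G}}) : m' \subset m -> matching m -> matching m'.
Proof.
move=> sub /andP[mE mT]; apply/andP; split; first exact: subset_trans mE.
exact: trivIsetS mT.
Qed.

Lemma mem_cover (e : {set G}) m u : e \in m -> u \in e -> u \in cover m.
Proof. by move=> em ue; apply/bigcupP; exists e. Qed.

(** Two edges of [m] through [u] would intersect, so the sum has at most one non-zero term. Written
    as a sum, this splits matchings by the partner of [u]. *)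
Lemma matching_edge_at m u : matching m ->
  (u \in cover m)%:R = \sum_(w | sadj u w) ([set u; w] \in m)%:R :> R.
Proof.
move=> /matchingP[mE mD].
case: (boolP (u \in cover m)) => [/bigcupP[e em ue]|uN]; last first.
  rewrite big1 // => w _; case: (boolP (_ \in m)) => // em.
  by rewrite (mem_cover em) ?inE ?eqxx in uN.
have [w uw eE] : exists2 w, sadj u w & e = [set u; w].
  move: (mE _ em); rewrite inE => /existsP[x /existsP[y /andP[xy /eqP eE]]].
  move: ue; rewrite eE !inE => /orP[]/eqP->; first by exists y.
  by exists x; rewrite 1?sadj_sym // setUC.
rewrite (bigD1 w) //= -eE em big1 ?addr0 // => w' /andP[uw' ww'].
case: (boolP (_ \in m)) => // em'.
have ne : e != [set u; w'].
  apply/eqP => ee; have : w' \in e by rewrite ee !inE eqxx orbT.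
  rewrite eE !inE (negbTE ww') orbF => /eqP w'u.
  by rewrite w'u sadj_irr in uw'.
move: (mD _ _ em em' ne) => /pred0P /(_ u).
by rewrite /= ue !inE eqxx.
Qed.

Lemma matching_sum_ge1 t S : 0 <= t -> 1 <= matching_sum t S.
Proof.
move=> t0; rewrite /matching_sum (bigD1 set0) /=; last first.
  by rewrite matching_set0 /cover big_set0 disjoints_subset sub0set.
by rewrite cards0 expr0 lerDl sumr_ge0 // => m _; rewrite exprn_ge0.
Qed.

Lemma matching_sum_gt0 t S : 0 <= t -> 0 < matching_sum t S.
Proof. by move=> t0; rewrite (lt_le_trans _ (matching_sum_ge1 S t0)). Qed.

Lemma matching_add_edge m (e : {set G}) : e \in edges G -> [disjoint e & cover m] ->
  matching (e |: m) = matching m.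
Proof.
move=> eE eD; apply/idP/idP; first by apply: matching_sub; exact: subsetUr.
move=> /andP[mE mT]; apply/andP; split.
  by rewrite finset.subUset sub1set eE.
have eDm : {in m, forall B : {set G}, [disjoint e & B]}.
  move=> B Bm; move: eD; rewrite -!setI_eq0 => /eqP eD.
  by rewrite -subset0 -eD setIS // (bigcup_sup B).
have m0 : set0 \notin m.
  by apply/negP => /(subsetP mE) /edge_card; rewrite cards0.
by have [] := trivIsetU1 eDm mT m0.
Qed.

Lemma cover_setU1 m (e : {set G}) : cover (e |: m) = e :|: cover m.
Proof. by rewrite /cover bigcup_setU big_set1. Qed.

Lemma disjoint_setU1 (A S : {set G}) u :
  [disjoint A & u |: S] = (u \notin A) && [disjoint A & S].
Proof. by rewrite !disjoints_subset setCU subsetI -disjoints_subset disjoint_sym disjoints1. Qed.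

(* Classify the matchings avoiding [S] by the edge covering [u]. *)
Lemma matching_sum_rec t S u : u \notin S ->
  matching_sum t S = matching_sum t (u |: S) +
    t * \sum_(w | sadj u w && (w \notin S)) matching_sum t (w |: (u |: S)).
Proof.
move=> uS; rewrite {1}/matching_sum.
rewrite (bigID (fun m => u \notin cover m)) /=; congr (_ + _).
  apply: eq_bigl => m; rewrite -andbA; congr (_ && _).
  by rewrite disjoint_setU1 andbC.
under eq_bigl => m do rewrite negbK.
transitivity (\sum_(m | matching m && [disjoint cover m & S])
   \sum_(w | sadj u w) ([set u; w] \in m)%:R * t ^+ #|m|).
  rewrite big_mkcondr; apply: eq_bigr => m /andP[mm _].
  by rewrite -mulr_suml -matching_edge_at //; case: (u \in _); rewrite ?mul1r ?mul0r.
rewrite exchange_big /= mulr_sumr big_mkcondr.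
apply: eq_bigr => w uw.
have uwN : u != w by apply/eqP => e; rewrite e sadj_irr in uw.
rewrite /matching_sum.
case: ifPn => wS; last first.
  apply: big1 => m /andP[mm mS]; case: (boolP (_ \in m)) => em; last by rewrite mul0r.
  rewrite negbK in wS; move/pred0P: mS => /(_ w) /=.
  by rewrite wS (mem_cover em) // !inE eqxx orbT.
rewrite mulr_sumr (bigID (fun m => [set u; w] \in m)) /= [X in _ + X]big1 ?addr0; last first.
  by move=> m /andP[_ /negbTE ->]; rewrite mul0r.
(* Deleting the edge [uw] is a bijection from the matchings that contain it onto the matchings of
   the graph without [u] and [w]. *)
rewrite (reindex_onto (fun m => [set u; w] |: m) (fun m => m :\ [set u; w])) /=; last first.
  by move=> m /andP[_ em]; rewrite finset.setD1K.
have eE : [set u; w] \in edges G by rewrite mem_edges.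
have key m : [&& matching m & [disjoint cover m & w |: (u |: S)]] ->
    [disjoint [set u; w] & cover m].
  move=> /andP[_]; rewrite -!setI_eq0 => /eqP h; apply/eqP/setP => x.
  move/setP/(_ x): h; rewrite !inE; case: (x == u); case: (x == w); rewrite //= ?andbT //.
have keyN m : [disjoint [set u; w] & cover m] -> [set u; w] \notin m.
  move=> /pred0P /(_ u) /=; rewrite !inE eqxx /= => uN.
  by apply: contraFN uN => em; rewrite (mem_cover em) ?inE ?eqxx.
apply: eq_big => [m|m /andP[/andP[/andP[mm mS] em] /eqP mD]]; last first.
  rewrite em mul1r -exprS; congr (_ ^+ _).
  have emN : [set u; w] \notin m by rewrite -mD !inE eqxx.
  by rewrite cardsU1 emN.
case: (boolP [disjoint [set u; w] & cover m]) => eD.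
  rewrite matching_add_edge // cover_setU1 setU11 setU1K ?keyN // eqxx !andbT.
  congr (_ && _); rewrite -!setI_eq0; apply/eqP/eqP => /setP h; apply/setP => x.
    move: (h x) (pred0P eD x); rewrite /= !inE.
    by case: (x == u); case: (x == w); case: (x \in cover m); case: (x \in S).
  move: (h x); rewrite /= !inE.
  case: (eqVneq x u) => [->|_]; first by rewrite (negbTE uS) andbF.
  case: (eqVneq x w) => [->|_]; first by rewrite (negbTE wS) andbF.
  by [].
(* When [m] meets the edge both sides fail, since each of them forces [m] to avoid [u] and [w]. *)
transitivity false; last by apply/esym/negbTE; apply: contra eD; exact: key.
apply/negbTE; apply: contra eD => /andP[/andP[/andP[/matchingP[_ mD] _] em] /eqP meq].
rewrite /cover bigcup_disjoint // => f fm; apply: mD => //.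
  by rewrite !inE fm orbT.
by apply: contraTneq fm => <-; rewrite -meq !inE eqxx.
Qed.
End MatchingSum.

(** * Correlation of uncovered vertices in a bipartite graph *)

Section Correlation.
Variables (R : realType) (G : sgraph) (t : R).
Hypothesis t0 : 0 <= t.
Implicit Types (S : {set G}) (u v w : G).
Local Notation Z := (matching_sum t).

(* The two inequalities feed each other in the induction: removing [u] turns a
   pair on the same side into pairs on opposite sides, and conversely. *)
Lemma matching_sum_correlation (A : {set G}) :
  (forall x y, sadj x y -> (x \in A) != (y \in A)) ->
  forall S u v, u \notin S -> v \notin S -> u != v ->
  if (u \in A) == (v \in A)
  then Z S * Z (v |: (u |: S)) <= Z (u |: S) * Z (v |: S)
  else Z (u |: S) * Z (v |: S) <= Z S * Z (v |: (u |: S)).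
Proof.
move=> bip S u; move En : #|~: S| => n.
elim: n S u En => [|n IHn] S u En v uS vS uv.
  by move/eqP: En; rewrite cards_eq0 => /eqP/setP/(_ u); rewrite !inE uS.
have Hn : #|~: (u |: S)| = n.
  by apply/eqP; rewrite -eqSS -En (cardsD1 u (~: S)) inE uS add1n eqSS;
    apply/eqP; congr #|pred_of_set _|; apply/setP => x; rewrite !inE negb_or.
have vH : v \notin u |: S by rewrite !inE eq_sym negb_or uv.
have HC : u |: (v |: S) = v |: (u |: S) by rewrite setUCA.
have uvS : u \notin v |: S by rewrite !inE negb_or uv.
(* Both factors that still contain [u] are expanded at [u]. The product
   [Z (u |: S) * Z (v |: (u |: S))] then appears on both sides and cancels, and what is left is
   compared neighbour by neighbour. *)
rewrite (matching_sum_rec t uS) (matching_sum_rec t uvS) HC.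
have IH w wH wv := IHn (u |: S) w Hn v wH vH wv.
have wH w : sadj u w -> w \notin S -> w \notin u |: S.
  by move=> uw wS; rewrite !inE negb_or wS andbT; apply: contraTneq uw => ->; rewrite sadj_irr.
case: ifPn => side.
  rewrite mulrDl mulrDr lerD2l -mulrA [leRHS]mulrCA ler_wpM2l // [leRHS]mulr_sumr [leLHS]mulr_suml.
  have PE w : sadj u w && (w \notin v |: S) = sadj u w && (w \notin S).
    case: (boolP (sadj u w)) => //= uw; rewrite !inE; case: eqP => // wv.
    by have := bip _ _ uw; rewrite wv side.
  rewrite [leRHS](eq_bigl _ _ PE).
  apply: ler_sum => w /andP[uw wS].
  have wv : w != v by apply: contraTneq uw => ->; apply/negP => /bip; rewrite side.
  have := IH w (wH w uw wS) wv.
  have /negbTE -> : (w \in A) != (v \in A).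
    by move: (bip _ _ uw); rewrite (eqP side); rewrite eq_sym.
  by rewrite [w |: (v |: _)]setUCA.
rewrite mulrDl mulrDr lerD2l -mulrA [leLHS]mulrCA ler_wpM2l // [leRHS]mulr_suml [leLHS]mulr_sumr.
(* Here [v] may be a neighbour of [u]. It then contributes only to the larger side, and its term is
   dropped as non-negative. *)
rewrite [leRHS](bigID (fun w => w == v)) /= -[leLHS]add0r lerD ?sumr_ge0 // => [w _|].
  by rewrite mulr_ge0 // ltW // matching_sum_gt0.
have PE w : sadj u w && (w \notin v |: S) = sadj u w && (w \notin S) && (w != v).
  by rewrite !inE negb_or -andbA; congr (_ && _); rewrite andbC.
rewrite [leLHS](eq_bigl _ _ PE).
apply: ler_sum => w /andP[/andP[uw wS] wv].
have := IH w (wH w uw wS) wv.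
have -> : (w \in A) == (v \in A).
  by move: (bip _ _ uw) side; do 3 case: (_ \in A).
by rewrite [w |: (v |: _)]setUCA.
Qed.
End Correlation.

Section Density.
Variables (R : realType) (G : sgraph).
Implicit Types (t : R) (S : {set G}) (u v w : G).
Local Notation Z := (@matching_sum R G).

Lemma card_gt0R : 0 < #|G|%:R :> R.
Proof. by rewrite ltr0n svertex_gt0. Qed.

(** Induction on the number of vertices outside [S]: the recursion refers only to adjacency, so no
    set of edges has to be transported along [phi]. *)
Lemma matching_sum_aut t (phi : {perm G}) S :
  automorphism phi -> Z t (phi @: S) = Z t S.
Proof.
move=> aut; have phiI := @perm_inj _ phi.
have [n] := ubnP #|~: S|; elim: n S => // n IHn S Hn.
have [S0|/set0Pn[u]] := eqVneq (~: S) set0.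
  rewrite -(setCK S) S0 setC0; congr matching_sum.
  by apply/setP => x; rewrite -[x](permKV phi) mem_imset ?inE //.
rewrite inE => uS.
have lt_card v S' : v \notin S' -> (#|~: (v |: S')| < #|~: S'|)%N.
  move=> vS; apply/proper_card/properP; split.
    by rewrite setCS subsetUr.
  by exists v; rewrite !inE ?vS ?eqxx.
have Hu : (#|~: (u |: S)| < n)%N by rewrite -ltnS (leq_trans _ Hn) // ltnS lt_card.
rewrite [RHS](matching_sum_rec t uS) (@matching_sum_rec _ _ t _ (phi u)); last first.
  by rewrite mem_imset //; exact: perm_inj.
have phiU v S' : phi v |: phi @: S' = phi @: (v |: S') by rewrite imsetU1.
rewrite phiU IHn //; congr (_ + _ * _).
rewrite (reindex_inj phiI) /=; apply: eq_big => [w|w /andP[_]].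
  by rewrite aut mem_imset //.
rewrite !phiU mem_imset // => wS; rewrite IHn //.
case: (boolP (w \in u |: S)) => [wI|wN]; last exact: ltn_trans (lt_card _ _ wN) _.
by rewrite setUC (setUidPl _) // sub1set.
Qed.

(** Stated for a general weight [c] so as to serve both for [M] and for [t M']. *)
Lemma matching_gen_sum (c : nat -> R) :
  \sum_(k < (#|G|./2).+1) (nb_matchings G k)%:R * c k =
  \sum_(m : {set {set G}} | matching m) c #|m|.
Proof.
rewrite [RHS](partition_big (fun m : {set {set G}} => inord #|m| : 'I_(#|G|./2).+1) predT) //=.
apply: eq_bigr => k _; rewrite /nb_matchings -sum1_card natr_sum mulr_suml.
apply: eq_big => [m|m]; last by rewrite inE mul1r => /andP[_ /eqP ->].
rewrite inE; case: (boolP (matching m)) => //= mm.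
rewrite -(inj_eq val_inj) /= inordK //.
by rewrite ltnS -(doubleK #|m|) half_leq // -mul2n matching_card_le.
Qed.

Lemma matching_sum0 t : Z t set0 = \sum_(m : {set {set G}} | matching m) t ^+ #|m|.
Proof.
by apply: eq_bigl => m; rewrite disjoint_sym disjoints_subset sub0set andbT.
Qed.

Lemma horner_matching_gen t : (matching_gen R G).[t] = Z t set0.
Proof. by rewrite horner_poly matching_gen_sum matching_sum0. Qed.

Lemma horner_matching_gen_deriv t : t * ((matching_gen R G)^`()).[t] =
  \sum_(m : {set {set G}} | matching m) #|m|%:R * t ^+ #|m|.
Proof.
rewrite -(matching_gen_sum (fun k => k%:R * t ^+ k)) /matching_gen poly_def.
rewrite raddf_sum /= horner_sum mulr_sumr; apply: eq_bigr => k _.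
rewrite derivZ derivXn hornerZ hornerMn hornerXn mulrCA; congr (_ * _).
by case: (k : nat) => [|j] /=; rewrite ?mulr0n ?mulr0 ?mul0r // -mulr_natl mulrCA -exprS.
Qed.

(** The expected proportion of uncovered vertices for a random matching of weight [t ^+ #|m|], that
    is [q(t)]. *)
Definition unmatched t : R := (\sum_u Z t [set u] / Z t set0) / #|G|%:R.

(** Double counting: in the sum over [u], a matching [m] appears once for each of the
    [#|G| - 2 * #|m|] vertices outside its cover. *)
Lemma matching_densityE t : 0 <= t ->
  matching_density G t = 1 - unmatched t.
Proof.
move=> t0; have Z0 : Z t set0 != 0 by rewrite gt_eqF // matching_sum_gt0.
have G0 : #|G|%:R != 0 :> R by rewrite gt_eqF // card_gt0R.
have e : \sum_u Z t [set u] = #|G|%:R * Z t set0 -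
    2 * \sum_(m : {set {set G}} | matching m) #|m|%:R * t ^+ #|m|.
  rewrite matching_sum0 mulr_sumr mulr_sumr -sumrB.
  rewrite /matching_sum (exchange_big_dep (@matching G)) /=; last by move=> i m _ /andP[].
  apply: eq_bigr => m mm.
  rewrite (eq_bigl (mem (~: cover m))); last first.
    by move=> u; rewrite mm disjoint_sym disjoints1 !inE.
  rewrite sumr_const cardsCs setCK card_cover_matching // -[LHS]mulr_natl.
  by rewrite natrB ?matching_card_le // natrM mulrBl mulrA.
rewrite /unmatched -mulr_suml e /matching_density horner_matching_gen horner_matching_gen_deriv.
have aux (a b c : R) : a * (2 * c * b) = 2 * a * b * c by lra.
rewrite invfM invf_div mulrBl mulrBl mulfK // divff // opprB addrC subrK.
exact: aux.
Qed.
End Density.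

(** * Decay of correlations *)

Section Ratio.
Variables (R : realType) (G : sgraph).
Implicit Types (t : R) (S : {set G}) (u v w : G).
Local Notation Z := (@matching_sum R G).

(** For [u] outside [S], the probability that the random matching of [G - S] misses [u]. *)
Definition unmatched_ratio t S u : R := Z t (u |: S) / Z t S.

Lemma unmatchedE t : unmatched G t = (\sum_u unmatched_ratio t set0 u) / #|G|%:R.
Proof.
by congr (_ / _); apply: eq_bigr => u _; rewrite /unmatched_ratio setU0.
Qed.

Lemma unmatched_ratio_gt0 t S u : 0 <= t -> 0 < unmatched_ratio t S u.
Proof. by move=> t0; rewrite divr_gt0 ?matching_sum_gt0. Qed.

Lemma unmatched_ratio_rec t S u : 0 <= t -> u \notin S ->
  unmatched_ratio t S u =
  (1 + t * \sum_(w | sadj u w && (w \notin S)) unmatched_ratio t (u |: S) w)^-1.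
Proof.
move=> t0 uS; rewrite /unmatched_ratio (matching_sum_rec t uS).
rewrite -[LHS]invrK invf_div; congr (_^-1).
by rewrite -mulr_suml mulrDl divff ?gt_eqF ?matching_sum_gt0 // mulrA.
Qed.

Lemma unmatched_ratio_le1 t S u : 0 <= t -> u \notin S -> unmatched_ratio t S u <= 1.
Proof.
move=> t0 uS; rewrite unmatched_ratio_rec // invf_le1; last first.
  by rewrite ltr_pwDl // mulr_ge0 // sumr_ge0 // => w _; rewrite ltW // unmatched_ratio_gt0.
by rewrite lerDl mulr_ge0 // sumr_ge0 // => w _; rewrite ltW // unmatched_ratio_gt0.
Qed.

Lemma unmatched_ge0 t : 0 <= t -> 0 <= unmatched G t.
Proof.
move=> t0; rewrite unmatchedE divr_ge0 // ?ler0n // sumr_ge0 // => u _.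
by rewrite ltW // unmatched_ratio_gt0.
Qed.

Variable D : nat.
Hypothesis degD : forall x : G, (#|[set y | sadj x y]| <= D)%N.

Lemma sum_neighbours_le u (P : pred G) (F : G -> R) :
  (forall w, sadj u w -> P w -> F w <= 1) ->
  \sum_(w | sadj u w && P w) F w <= D%:R.
Proof.
move=> F1; apply: (@le_trans _ _ (\sum_(w | sadj u w && P w) 1)).
  by apply: ler_sum => w /andP[]; exact: F1.
rewrite sumr_const ler_nat (leq_trans _ (degD u)) //.
by apply/subset_leq_card/subsetP => w; rewrite !inE => /andP[].
Qed.

Lemma notin_setU1_neighbour u w S : sadj u w -> w \notin S -> w \notin u |: S.
Proof.
move=> uw wS; rewrite !inE negb_or wS andbT.
by apply: contraTneq uw => ->; rewrite sadj_irr.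
Qed.

Lemma unmatched_ratio_ge t S u : 0 <= t -> u \notin S ->
  1 <= (1 + t * D%:R) * unmatched_ratio t S u.
Proof.
move=> t0 uS; rewrite unmatched_ratio_rec //.
set s := \sum_(w | _) _.
have s0 : 0 <= s by apply: sumr_ge0 => w _; rewrite ltW // unmatched_ratio_gt0.
rewrite ler_pdivlMr ?mul1r ?ltr_pwDl ?mulr_ge0 // lerD2l ler_wpM2l //.
apply: sum_neighbours_le => w uw wS; rewrite unmatched_ratio_le1 //.
exact: notin_setU1_neighbour.
Qed.

Lemma unmatched_ge t : 0 <= t -> 1 <= (1 + t * D%:R) * unmatched G t.
Proof.
move=> t0; rewrite unmatchedE mulrA ler_pdivlMr ?card_gt0R // mul1r mulr_sumr.
rewrite -sum1_card natr_sum; apply: ler_sum => u _.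
by rewrite unmatched_ratio_ge // inE.
Qed.

(** Vertices are deleted one at a time, and by [unmatched_ratio_ge] each deletion costs a factor of
    at most [1 + t * D%:R]. *)
Lemma matching_sum_le t S : 0 <= t -> Z t S <= (1 + t * D%:R) ^+ #|~: S|.
Proof.
move=> t0; move En : #|~: S| => n; elim: n S En => [|n IHn] S En.
  rewrite expr0 /matching_sum (bigD1 set0) /=; last first.
    by rewrite matching_set0 /cover big_set0 disjoints_subset sub0set.
  rewrite cards0 expr0 big1 ?addr0 // => m /andP[/andP[mm mS] m0].
  have : cover m = set0.
    apply/eqP; rewrite -subset0 -(setCK set0) setC0 -disjoints_subset.
    by move/eqP: En; rewrite cards_eq0 => /eqP/(congr1 (@finset.setC _)); rewrite setCK setC0 => <-.
  move=> c0; have := card_cover_matching mm; rewrite c0 cards0 => /esym/eqP.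
  by rewrite muln_eq0 /= cards_eq0 (negbTE m0).
have /card_gt0P[u] : (0 < #|~: S|)%N by rewrite En.
rewrite inE => uS.
have Hn : #|~: (u |: S)| = n.
  move: En; rewrite (cardsD1 u) inE uS add1n => -[<-].
  by congr #|pred_of_set _|; apply/setP => x; rewrite !inE negb_or.
have := unmatched_ratio_ge t0 uS; rewrite /unmatched_ratio mulrA.
rewrite ler_pdivlMr ?matching_sum_gt0 // mul1r => /le_trans; apply.
by rewrite exprS ler_wpM2l ?IHn // addr_ge0 // mulr_ge0.
Qed.

(** The recursion of [unmatched_ratio] unrolled [k] times with the value 1 at the leaves. It
    explores the tree of self-avoiding walks of length at most [k] from [u]. *)
Fixpoint truncated_ratio t k S u : R :=
  if k is k'.+1 then
    (1 + t * \sum_(w | sadj u w && (w \notin S)) truncated_ratio t k' (u |: S) w)^-1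
  else 1.

Lemma truncated_ratio_bound t k S u : 0 <= t -> 0 < truncated_ratio t k S u <= 1.
Proof.
move=> t0; elim: k S u => [|k IHk] S u /=; first by rewrite ltr01 lexx.
have s0 : 0 <= t * \sum_(w | sadj u w && (w \notin S)) truncated_ratio t k (u |: S) w.
  by rewrite mulr_ge0 // sumr_ge0 // => w _; case/andP: (IHk (u |: S) w) => /ltW.
by rewrite invr_gt0 ltr_pwDl // invf_le1 ?ltr_pwDl // lerDl s0.
Qed.

(** The largest value of [t x / (1 + t x)] for [0 <= t <= T] and [0 <= x <= D]. This quotient is the
    derivative of [ln (1 + t x)] in [ln x], hence the factor by which one step multiplies a small
    relative error. *)
Definition decay (T : R) : R := T * D%:R / (1 + T * D%:R).

Lemma decay_bound T : 0 <= T -> 0 <= decay T < 1.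
Proof.
move=> T0; have TD : 0 <= T * D%:R by rewrite mulr_ge0.
by rewrite divr_ge0 ?addr_ge0 //= ltr_pdivrMr ?ltr_pwDl // mul1r ltrDr.
Qed.

(** A relative error on [x] affects only the share [t x] of [1 + t x], and this share is at most
    [decay T]. *)
Lemma contraction T t rho x y : 0 <= t <= T -> 1 <= rho -> 0 <= x <= D%:R -> y <= rho * x ->
  1 + t * y <= (1 + (rho - 1) * decay T) * (1 + t * x).
Proof.
move=> /andP[t0 tT] rho1 /andP[x0 xD] yx.
have T0 := le_trans t0 tT.
have TD : 0 <= T * D%:R by rewrite mulr_ge0.
have h : t * x <= decay T * (1 + t * x).
  rewrite /decay mulrAC ler_pdivlMr ?ltr_pwDl //.
  have : t * x <= T * D%:R by rewrite ler_pM.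
  nra.
have h1 : t * y <= t * (rho * x) by rewrite ler_wpM2l.
have h2 : (rho - 1) * (t * x) <= (rho - 1) * (decay T * (1 + t * x)).
  by rewrite ler_wpM2l // subr_ge0.
lra.
Qed.

(* The recursion contracts the relative error of the ratios. *)
Lemma truncated_ratio_approx T t k S u : 0 <= t <= T -> u \notin S ->
  let rho := 1 + T * D%:R * decay T ^+ k in
  truncated_ratio t k S u <= rho * unmatched_ratio t S u /\
  unmatched_ratio t S u <= rho * truncated_ratio t k S u.
Proof.
move=> tT; have /andP[t0 t_T] := tT; have T0 := le_trans t0 t_T.
have TD : 0 <= T * D%:R by rewrite mulr_ge0.
have /andP[k0 k1] := decay_bound T0.
elim: k S u => [|k IHk] S u uS rho.
  (* At depth 0 the constant 1 is compared with a ratio lying between [1 / (1 + T * D)] and 1. *)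
  rewrite /rho expr0 mulr1 /= mulr1; split.
    apply: le_trans (unmatched_ratio_ge t0 uS) _.
    by rewrite ler_wpM2r ?lerD2l ?ler_wpM2r // ltW // unmatched_ratio_gt0.
  by apply: le_trans (unmatched_ratio_le1 t0 uS) _; rewrite lerDl.
rewrite unmatched_ratio_rec // [truncated_ratio _ _ _ _]/=.
set r := 1 + T * D%:R * decay T ^+ k in IHk.
have rhoE : rho = 1 + (r - 1) * decay T by rewrite /rho /r exprSr; lra.
have r1 : 1 <= r by rewrite lerDl mulr_ge0 // exprn_ge0.
set x := \sum_(w | _) _; set y := \sum_(w | _) _.
have x0 : 0 <= x <= D%:R.
  rewrite sumr_ge0 => [|w _] /=; last by case/andP: (truncated_ratio_bound k (u |: S) w t0) => /ltW.
  by apply: sum_neighbours_le => w _ _; case/andP: (truncated_ratio_bound k (u |: S) w t0).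
have y0 : 0 <= y <= D%:R.
  rewrite sumr_ge0 => [|w _] /=; last by rewrite ltW // unmatched_ratio_gt0.
  apply: sum_neighbours_le => w uw wS; rewrite unmatched_ratio_le1 //.
  exact: notin_setU1_neighbour.
have IH w (h : sadj u w && (w \notin S)) :=
  IHk (u |: S) w (notin_setU1_neighbour (proj1 (andP h)) (proj2 (andP h))).
have xy : x <= r * y by rewrite mulr_sumr; apply: ler_sum => w /IH[].
have yx : y <= r * x by rewrite mulr_sumr; apply: ler_sum => w /IH[].
have dx : 0 < 1 + t * x by rewrite ltr_pwDl // mulr_ge0 //; case/andP: x0.
have dy : 0 < 1 + t * y by rewrite ltr_pwDl // mulr_ge0 //; case/andP: y0.
(* Inversion reverses the order, so each inequality comes from the opposite one at the previous
   depth; this is why both are carried. *)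
rewrite rhoE; split; rewrite ler_pdivlMr // ler_pdivrMl // [leRHS]mulrC.
  exact: contraction.
exact: contraction.
Qed.

(** Both ratios are at most 1, so the relative error also bounds the absolute one. *)
Lemma truncated_ratio_dist T t k S u : 0 <= t <= T -> u \notin S ->
  `|truncated_ratio t k S u - unmatched_ratio t S u| <= T * D%:R * decay T ^+ k.
Proof.
move=> tT uS; have /andP[t0 t_T] := tT; have T0 := le_trans t0 t_T.
have [h1 h2] := truncated_ratio_approx k tT uS.
have /andP[/ltW q0 q1] := truncated_ratio_bound k S u t0.
have p0 := ltW (unmatched_ratio_gt0 S u t0); have p1 := unmatched_ratio_le1 t0 uS.
have e0 : 0 <= T * D%:R * decay T ^+ k.
  by rewrite !mulr_ge0 ?exprn_ge0 //; case/andP: (decay_bound T0).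
rewrite ler_norml; apply/andP; split; nra.
Qed.
End Ratio.

(** * The uniform bound for vertex-transitive bipartite graphs *)

Section Transitive.
Variables (R : realType) (G : sgraph) (d : nat).
Hypothesis vt : vertex_transitive G.
Hypothesis bip : bipartite G.
Hypothesis reg : regular_graph G d.

Lemma unmatched_transitive (t : R) (u : G) :
  unmatched G t = unmatched_ratio t set0 u.
Proof.
have G0 : #|G|%:R != 0 :> R by rewrite gt_eqF // card_gt0R.
rewrite unmatchedE (eq_bigr (fun=> unmatched_ratio t set0 u)) => [|v _].
  by rewrite sumr_const -[X in X / _]mulr_natr mulfK.
rewrite /unmatched_ratio !setU0; have [phi aut <-] := vt u v.
by rewrite -imset_set1 matching_sum_aut.
Qed.

(** The recursion at [u] bounds [Z set0] below by [t] times the sum of [Z [set u; w]] over the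
    neighbours [w]. These lie on the opposite side, so [Z set0 * Z [set u; w]] is at least [Z
    [set u] * Z [set w]], which is [Z [set u] ^+ 2] by transitivity. *)
Lemma unmatched_sqr_le (t : R) : 0 <= t -> unmatched G t ^+ 2 * (t * d%:R) <= 1.
Proof.
move=> t0; have [A bipA] := bip.
have [u _] : exists u : G, u \in G by apply/card_gt0P; exact: svertex_gt0.
have Z0 : 0 < matching_sum t (set0 : {set G}) by rewrite matching_sum_gt0.
have h : t * (d%:R * (matching_sum t [set u] ^+ 2)) <= matching_sum t (set0 : {set G}) ^+ 2.
  rewrite [in leRHS]expr2 {2}(@matching_sum_rec _ _ t set0 u) ?inE //.
  rewrite mulrDr -[leLHS]add0r; apply: lerD.
    by rewrite mulr_ge0 ?ltW ?matching_sum_gt0.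
  rewrite [leRHS]mulrCA ler_wpM2l // -(reg u) -sum1_card natr_sum [leLHS]mulr_suml [leRHS]mulr_sumr.
  rewrite [leRHS](eq_bigl (fun w => w \in [set y | sadj u y])); last first.
    by move=> w; rewrite !inE andbT.
  apply: ler_sum => w; rewrite inE => uw; rewrite mul1r expr2.
  have uw' : u != w by apply: contraTneq uw => ->; rewrite sadj_irr.
  have := matching_sum_correlation t0 bipA (negbT (in_set0 u)) (negbT (in_set0 w)) uw'.
  rewrite (negbTE (bipA _ _ uw)) !setU0.
  have [phi aut <-] := vt u w.
  by rewrite -[[set phi u]]imset_set1 (matching_sum_aut _ _ aut).
rewrite (unmatched_transitive t u) /unmatched_ratio setU0 expr_div_n mulrAC.
by rewrite ler_pdivrMr ?exprn_gt0 // mul1r (le_trans _ h) // mulrC mulrA.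
Qed.
End Transitive.

(** * Balls and their frequencies *)

Definition ball_point (G : Defs.rgraph) (r : nat) (x : rvertex G)
    (xB : x \in @ball_vertices G r) : rvertex (rball G r) := exist _ x xB.

Section Locality.
Variables (R : realType) (t : R).

(** The walk [s] records how the recursion reached [h x] from [v]. With [k] steps left, all vertices
    still visited end walks of length at most [r] from [v], hence lie in the image of [h]. *)
Lemma truncated_ratio_embedding (G A : sgraph) (h : A -> G) (v : G) (r : nat) :
  injective h -> (forall x y, sadj (h x) (h y) = sadj x y) ->
  (forall s, (size s <= r)%N -> path (@sadj G) v s -> last v s \in codom h) ->
  forall k (x : A) (S : {set A}) s, (size s + k <= r)%N -> path (@sadj G) v s ->
  last v s = h x -> truncated_ratio t k (h @: S) (h x) = truncated_ratio t k S x.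
Proof.
move=> hI hA hB; elim=> [//|k IHk] x S s sr ps ls /=.
congr (1 + t * _)^-1.
have -> : \sum_(y | sadj x y && (y \notin S)) truncated_ratio t k (x |: S) y =
    \sum_(y in [set y | sadj x y && (y \notin S)]) truncated_ratio t k (h @: (x |: S)) (h y).
  apply: eq_big => [y|y /andP[xy yS]]; first by rewrite inE.
  rewrite (IHk _ _ (rcons s (h y))) ?last_rcons //; first by rewrite size_rcons addSnnS.
  by rewrite rcons_path ps ls hA.
rewrite -(big_imset (fun w => truncated_ratio t k (h @: (x |: S)) w)) /=; last first.
  by move=> y z _ _; exact: hI.
apply: eq_big => [w|w _]; last by rewrite imsetU1.
apply/andP/imsetP => [[xw wS]|[y]]; last by rewrite inE => /andP[xy yS] ->; rewrite hA mem_imset.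
have /codomP[y wy] : w \in codom h.
  rewrite -(last_rcons v s w); apply: hB; last by rewrite rcons_path ps ls.
  by rewrite size_rcons (leq_trans _ sr) // addnS ltnS leq_addr.
exists y => //; rewrite inE.
by move: xw wS; rewrite wy hA mem_imset // => -> ->.
Qed.

Lemma truncated_ratio_ball (G : sgraph) (v : G) (r : nat) (a : rooted_sgraph) :
  rooted_iso (rball (root_at v) r) (rgraph_of_sgraph a) ->
  truncated_ratio t r set0 v = truncated_ratio t r set0 (rsg_root a).
Proof.
case=> f [[g fK gK] froot fA].
pose h (x : rsg_graph a) : G := val (g x).
have hroot : h (rsg_root a) = v by rewrite /h -[rsg_root a]froot fK.
rewrite -hroot -(imset0 h).
apply: (@truncated_ratio_embedding _ _ h v r _ _ _ r _ _ [::]) => //.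
- by move=> x y /val_inj/(congr1 f); rewrite !gK.
- by move=> x y; have := fA (g x) (g y); rewrite !gK => /= ->.
move=> s sr ps; apply/codomP.
have sB : last v s \in @ball_vertices (root_at v) r by apply/mem_set; exists s.
by exists (f (ball_point sB)); rewrite /h fK.
Qed.
End Locality.

Lemma rooted_iso_sym (X Y : Defs.rgraph) : rooted_iso X Y -> rooted_iso Y X.
Proof.
case=> f [[g fK gK] froot fA]; exists g; split; first by exists f.
  by rewrite -froot fK.
by move=> x y; rewrite -fA !gK.
Qed.

Lemma rooted_iso_trans (X Y Z : Defs.rgraph) :
  rooted_iso X Y -> rooted_iso Y Z -> rooted_iso X Z.
Proof.
case=> f [fB froot fA] [g [gB groot gA]]; exists (g \o f); split => /=.
- exact: bij_comp.
- by rewrite froot groot.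
- by move=> x y; rewrite gA fA.
Qed.

(** * A finite list of all possible balls of bounded degree *)

Section Codes.

(** A finite type of adjacency tables on [m.+1 <= N] vertices, so that the ball frequencies at a
    given radius form a finite vector. *)
Definition ball_code (N : nat) := {m : 'I_N & {ffun 'I_m.+1 * 'I_m.+1 -> bool}}.

(* Symmetrizing makes every code the code of a simple graph. *)
Definition code_adj N (c : ball_code N) : rel 'I_(tag c).+1 :=
  fun x y => (x != y) && (tagged c (x, y) || tagged c (y, x)).

Lemma code_adj_sym N (c : ball_code N) : symmetric (@code_adj N c).
Proof. by move=> x y; rewrite /code_adj eq_sym orbC. Qed.

Lemma code_adj_irr N (c : ball_code N) : irreflexive (@code_adj N c).
Proof. by move=> x; rewrite /code_adj eqxx. Qed.

Lemma code_card_gt0 N (c : ball_code N) : (0 < #|'I_(tag c).+1|)%N.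
Proof. by rewrite card_ord. Qed.

Definition code_graph N (c : ball_code N) : rooted_sgraph :=
  @RootedSGraph (SGraph (@code_adj_sym N c) (@code_adj_irr N c) (code_card_gt0 c)) ord0.

Lemma ball_card_le (G : sgraph) (D : nat) (v : G) (r : nat) :
  (forall x : G, (#|[set y | sadj x y]| <= D)%N) ->
  (#|[set x : G | `[< @ball_vertices (root_at v) r x >]]| <= D.+1 ^ r)%N.
Proof.
move=> degD; elim: r => [|r IHr].
  rewrite expn0 -(cards1 v); apply/subset_leq_card/subsetP => x.
  by rewrite !inE => /asboolP[[|? ?] [//= _ _ ->]].
set B := [set x | _] in IHr.
apply: (@leq_trans #|\bigcup_(x in B) (x |: [set y | sadj x y])|).
  apply/subset_leq_card/subsetP => x; rewrite inE => /asboolP[s [sr ps ls]].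
  apply/bigcupP; case: (leqP (size s) r) => sr'.
    exists x; last by rewrite !inE eqxx.
    by rewrite inE; apply/asboolP; exists s.
  case/lastP: s ps ls sr sr' => // s y; rewrite rcons_path last_rcons => /andP[ps xy] <-.
  rewrite size_rcons !ltnS => sr _; exists (last v s); last by rewrite !inE; apply/orP; right.
  by rewrite inE; apply/asboolP; exists s.
apply: (@leq_trans (\sum_(x in B) D.+1)); last first.
  by rewrite sum_nat_const expnSr leq_mul2r IHr orbT.
elim/big_rec2: _ => [|x n A _ AB]; first by rewrite cards0.
rewrite (leq_trans (leq_card_setU _ _)) // leq_add //.
by rewrite (leq_trans (leq_card_setU _ _)) // cards1 add1n ltnS.
Qed.

Lemma exists_ball_code (G : sgraph) (D : nat) (v : G) (r : nat) :
  (forall x : G, (#|[set y | sadj x y]| <= D)%N) ->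
  exists c : ball_code (D.+1 ^ r),
    rooted_iso (rball (root_at v) r) (rgraph_of_sgraph (code_graph c)).
Proof.
move=> degD; set N := (D.+1 ^ r)%N.
pose B : {set G} := [set x : G | `[< @ball_vertices (root_at v) r x >]].
have BP x : reflect (@ball_vertices (root_at v) r x) (x \in B).
  by rewrite inE; exact: asboolP.
have vB : v \in B by apply/BP; exists [::].
have hm : (#|B :\ v| < N)%N.
  by have := ball_card_le v r degD; rewrite -/B (cardsD1 v) vB.
(* Listing [v] first gives it index 0, the root of every code. *)
pose s := v :: enum (B :\ v).
have s_uniq : uniq s by rewrite /= enum_uniq mem_enum !inE eqxx.
have s_mem x : (x \in s) = (x \in B).
  by rewrite in_cons mem_enum in_setD1; case: eqVneq => [->|] //=; rewrite vB.
have s_size : size s = #|B :\ v|.+1 by rewrite /= -cardE.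
pose h (i : 'I_(#|B :\ v|).+1) : G := nth v s i.
have hB i : h i \in @ball_vertices (root_at v) r.
  by apply/mem_set/BP; rewrite -s_mem mem_nth // s_size.
have hI : injective h.
  by move=> i j /eqP; rewrite nth_uniq ?s_size // => /eqP/val_inj.
pose c : ball_code N := Tagged (fun m : 'I_N => {ffun 'I_m.+1 * 'I_m.+1 -> bool})
  (i := Ordinal hm) [ffun p : 'I_(#|B :\ v|).+1 * 'I_(#|B :\ v|).+1 => sadj (h p.1) (h p.2)].
exists c; apply: rooted_iso_sym.
exists (fun i => ball_point (hB i)); split.
- exists (fun x => inord (index (val x) s)).
    move=> i; have e : index (\val (ball_point (hB i))) s = i.
      by rewrite index_uniq ?s_size.
    by rewrite e inord_val.
  move=> [x xB]; apply: val_inj; change (h (inord (index x s)) = x).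
  have xs : x \in s by rewrite s_mem; apply/BP/set_mem.
  by rewrite /h inordK ?nth_index // -s_size index_mem.
- exact: val_inj.
move=> x y; rewrite /= /ball_adj /= /code_adj /= !ffunE /=.
case: eqP => [->|_]; first by rewrite sadj_irr.
by rewrite /= [sadj (h y) _]sadj_sym orbb.
Qed.
End Codes.

Section BallAverages.
Variable R : realType.

Definition has_code N (X : Defs.rgraph) (c : ball_code N) : bool :=
  `[< rooted_iso X (rgraph_of_sgraph (code_graph c)) >].

(* A code may be isomorphic to others; [pick] selects one code in each class. *)
Definition canonical_code N (c : ball_code N) : bool :=
  [pick c' : ball_code N | has_code (rgraph_of_sgraph (code_graph c)) c'] == Some c.

Lemma pick_code N (X : Defs.rgraph) (c : ball_code N) :
  ([pick c' : ball_code N | has_code X c'] == Some c) = canonical_code c && has_code X c.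
Proof.
have pickE : has_code X c ->
    [pick c' : ball_code N | has_code X c'] =
    [pick c' : ball_code N | has_code (rgraph_of_sgraph (code_graph c)) c'].
  move=> /asboolP Xc; apply: eq_pick => c'; apply/asboolP/asboolP => h.
    exact: rooted_iso_trans (rooted_iso_sym Xc) h.
  exact: rooted_iso_trans Xc h.
apply/eqP/andP => [Xc|[/eqP cc Xc]]; last by rewrite pickE.
have h : has_code X c by move: Xc; case: pickP => // c' h [<-].
by split=> //; rewrite /canonical_code -pickE // Xc.
Qed.

(** Each ball has exactly one canonical code, and the vertices are grouped by it. *)
Lemma ball_average (G : sgraph) N (r : nat) (F : G -> R) (f : ball_code N -> R) :
  (forall v : G, exists c : ball_code N, has_code (rball (root_at v) r) c) ->
  (forall v c, has_code (rball (root_at v) r) c -> F v = f c) ->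
  (\sum_v F v) / #|G|%:R =
  \sum_(c | canonical_code c) ball_freq R G (code_graph c) r * f c.
Proof.
move=> hex hF.
have FE v : F v =
    \sum_(c : ball_code N | canonical_code c) (has_code (rball (root_at v) r) c)%:R * f c.
  transitivity (\sum_(c : ball_code N |
      [pick c' : ball_code N | has_code (rball (root_at v) r) c'] == Some c) f c).
    case: pickP => [c h|]; last by have [c] := hex v => h /(_ c); rewrite h.
    rewrite (big_pred1 c); first exact: hF.
    by move=> c'; rewrite /= eq_sym.
  rewrite (eq_bigl _ _ (pick_code _)) big_mkcondr.
  by apply: eq_bigr => c _; case: (has_code _ _); rewrite ?mul1r ?mul0r.
rewrite (eq_bigr _ (fun v _ => FE v)) exchange_big /= mulr_suml.
apply: eq_bigr => c _; rewrite -mulr_suml mulrAC; congr (_ / _ * _).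
rewrite -sum1_card natr_sum [LHS](bigID (fun v : G => has_code (rball (root_at v) r) c)) /=.
rewrite [X in _ + X]big1 ?addr0; last by move=> v /negbTE ->.
by apply: eq_big => [v|v ->//]; rewrite inE.
Qed.

(** Averages of truncated ratios are the same linear function of the ball frequencies in [G] and in
    [H], with coefficients in [[0, 1]]. The factor 2 counts one truncation error for each graph. *)
Lemma unmatched_dist (D r : nat) (T t : R) (G H : sgraph) : 0 <= t <= T ->
  (forall x : G, (#|[set y | sadj x y]| <= D)%N) ->
  (forall x : H, (#|[set y | sadj x y]| <= D)%N) ->
  `|unmatched G t - unmatched H t| <= 2 * (T * D%:R * decay D T ^+ r) +
    \sum_(c : ball_code (D.+1 ^ r))
      `|ball_freq R G (code_graph c) r - ball_freq R H (code_graph c) r|.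
Proof.
move=> tT degG degH; have /andP[t0 _] := tT.
pose f (c : ball_code (D.+1 ^ r)) : R := truncated_ratio t r set0 (rsg_root (code_graph c)).
pose A (K : sgraph) : R := \sum_(c | canonical_code c) ball_freq R K (code_graph c) r * f c.
have step (K : sgraph) : (forall x : K, (#|[set y | sadj x y]| <= D)%N) ->
    `|unmatched K t - A K| <= T * D%:R * decay D T ^+ r.
  move=> degK; have K0 : 0 < #|K|%:R :> R by exact: card_gt0R.
  rewrite /A -(@ball_average K _ r (fun v => truncated_ratio t r set0 v)); last first.
  - by move=> v c /asboolP /truncated_ratio_ball ->.
  - by move=> v; have [c h] := exists_ball_code v r degK; exists c; apply/asboolP.
  rewrite unmatchedE -mulrBl -sumrB normrM (gtr0_norm (_ : 0 < #|K|%:R^-1)) ?invr_gt0 //.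
  rewrite ler_pdivrMr // (le_trans (ler_norm_sum _ _ _)) //.
  rewrite [leRHS](_ : _ = \sum_(v : K) T * D%:R * decay D T ^+ r).
    by apply: ler_sum => v _; rewrite distrC truncated_ratio_dist // inE.
  by rewrite sumr_const -[RHS]mulr_natr.
have stepA : `|A G - A H| <= \sum_(c : ball_code (D.+1 ^ r))
      `|ball_freq R G (code_graph c) r - ball_freq R H (code_graph c) r|.
  rewrite /A -sumrB (le_trans (ler_norm_sum _ _ _)) //.
  rewrite [leRHS](bigID (@canonical_code _)) /= -[leLHS]addr0; apply: lerD; last first.
    exact: sumr_ge0.
  apply: ler_sum => c _; rewrite -mulrBl normrM -[leRHS]mulr1 ler_wpM2l //.
  have /andP[/ltW ? ?] := truncated_ratio_bound r set0 (rsg_root (code_graph c)) t0.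
  by rewrite ger0_norm.
have hG := step _ degG; have hH := step _ degH.
rewrite (_ : unmatched G t - unmatched H t =
  (unmatched G t - A G) + (A G - A H) - (unmatched H t - A H)); last first.
  move: (unmatched G t) (unmatched H t) (A G) (A H) => a b c e; lra.
rewrite (le_trans (ler_normB _ _)) //.
rewrite [leRHS](_ : _ = T * D%:R * decay D T ^+ r + \sum_(c : ball_code (D.+1 ^ r))
      `|ball_freq R G (code_graph c) r - ball_freq R H (code_graph c) r|
      + T * D%:R * decay D T ^+ r); last first.
  by move: (\sum_(c : _) _) (T * _ * _) => a b; lra.
by rewrite lerD // (le_trans (ler_normD _ _)) // lerD.
Qed.
End BallAverages.

(** * Convexity and local dependence of the free energy *)

Section Pressure.
Variables (R : realType) (G : sgraph).
Implicit Types (s t : R).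
Local Notation Z := (@matching_sum R G).

Definition pressure t : R := ln (matching_gen R G).[t] / #|G|%:R.

Definition mean_matching_size t : R :=
  (\sum_(m : {set {set G}} | matching m) #|m|%:R * t ^+ #|m|) / Z t set0.

Lemma mean_matching_sizeE t : 0 <= t ->
  1 - unmatched G t = mean_matching_size t * (2 / #|G|%:R).
Proof.
move=> t0; rewrite -matching_densityE // /matching_density horner_matching_gen.
rewrite horner_matching_gen_deriv /mean_matching_size invfM invf_div -[RHS]mulrA.
by congr (_ * _); rewrite mulrC.
Qed.

Lemma matching_gen_gt0 t : 0 <= t -> 0 < (matching_gen R G).[t].
Proof. by move=> t0; rewrite horner_matching_gen matching_sum_gt0. Qed.

(* Jensen's inequality for the size of a matching drawn with weights [t ^+ #|m|]:
   [ln M] is a convex function of [ln t]. *)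
Lemma pressure_convex s t : 0 < s -> 0 < t ->
  2^-1 * (1 - unmatched G t) * (ln s - ln t) <= pressure s - pressure t.
Proof.
move=> s0 t0; have [s0' t0'] := (ltW s0, ltW t0).
have G0 : 0 < #|G|%:R :> R by exact: card_gt0R.
have Z0 : 0 < Z t set0 by rewrite matching_sum_gt0.
set x := ln s - ln t; set mu := mean_matching_size t.
have key : expR (x * mu) * Z t set0 <= Z s set0.
  (* As [mu] is the mean of [#|m|], the linear term sums to zero; with it inserted,
     [1 + y <= expR y] applies matching by matching. *)
  have -> : expR (x * mu) * Z t set0 = \sum_(m : {set {set G}} | matching m)
      expR (x * mu) * (1 + (#|m|%:R - mu) * x) * t ^+ #|m|.
    under eq_bigr => m _ do rewrite -mulrA [(1 + _) * _]mulrDl mul1r.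
    rewrite -mulr_sumr big_split /= -matching_sum0.
    rewrite [X in _ + X](_ : _ = 0) ?addr0 //.
    under eq_bigr => m _ do rewrite mulrAC mulrBl.
    rewrite -mulr_suml sumrB -mulr_sumr -matching_sum0 /mu /mean_matching_size.
    by rewrite divfK ?gt_eqF // subrr mul0r.
  rewrite [leRHS]matching_sum0; apply: ler_sum => m _.
  have aux (a b c : R) : a * b + (c - b) * a = c * a by lra.
  have -> : s ^+ #|m| = expR (x * mu) * expR ((#|m|%:R - mu) * x) * t ^+ #|m|.
    rewrite -expRD (_ : x * mu + _ = #|m|%:R * x); last exact: aux.
    by rewrite mulrC expRM_natl /x expRB !lnK // expr_div_n mulrC divfK // expf_neq0 // gt_eqF.
  by rewrite ler_wpM2r ?exprn_ge0 // ler_wpM2l ?expR_ge0 // expR_ge1Dx.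
rewrite mean_matching_sizeE // -/mu /pressure !horner_matching_gen -mulrBl.
rewrite [leLHS](_ : _ = x * mu / #|G|%:R); last first.
  by move: (#|G|%:R^-1) => a; lra.
rewrite ler_wpM2r ?invr_ge0 ?(ltW G0) // -ln_div ?posrE ?matching_sum_gt0 //.
rewrite -[leLHS]expRK ler_ln ?posrE ?expR_gt0 ?divr_gt0 ?matching_sum_gt0 //.
by rewrite ler_pdivlMr.
Qed.

(** The sum of the tangent inequalities at [s] and at [t]: the slope of a convex function is
    monotone. *)
Lemma unmatched_nonincreasing s t : 0 < s -> s <= t -> unmatched G t <= unmatched G s.
Proof.
move=> s0; rewrite le_eqVlt => /orP[/eqP->//|st]; have t0 := lt_trans s0 st.
have h1 := pressure_convex s0 t0; have h2 := pressure_convex t0 s0.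
have : 0 < ln t - ln s by rewrite subr_gt0 ltr_ln.
move: (pressure s) (pressure t) (unmatched G s) (unmatched G t) (ln s) (ln t) h1 h2.
move=> a b c d x y; nra.
Qed.

Lemma pressure_bound (D : nat) t : (forall x : G, (#|[set y | sadj x y]| <= D)%N) ->
  0 <= t -> 0 <= pressure t <= t * D%:R.
Proof.
move=> degD t0; have G0 : 0 < #|G|%:R :> R by exact: card_gt0R.
rewrite /pressure horner_matching_gen; apply/andP; split.
  by rewrite divr_ge0 ?ln_ge0 ?matching_sum_ge1.
rewrite ler_pdivrMr //; have := matching_sum_le degD set0 t0.
rewrite setC0 cardsT => h; have tD : 0 <= t * D%:R by rewrite mulr_ge0.
apply: (@le_trans _ _ (ln ((1 + t * D%:R) ^+ #|G|))).
  by rewrite ler_ln ?posrE ?matching_sum_gt0 ?exprn_gt0 ?ltr_pwDl.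
rewrite lnXn ?ltr_pwDl // -[ln _ *+ _]mulr_natr ler_wpM2r // le_ln1Dx //.
by rewrite (lt_le_trans _ tD).
Qed.

Lemma is_derive_pressure t : 0 < t ->
  is_derive t 1 pressure (2^-1 * (1 - unmatched G t) / t).
Proof.
move=> t0; have M0 := matching_gen_gt0 (ltW t0).
have -> : pressure = #|G|%:R^-1 *: (@ln R \o horner (matching_gen R G)).
  by apply/funext => x; rewrite /pressure /= mulrC.
have h1 := is_derive1_comp (is_derive1_ln M0) (is_derive_poly (matching_gen R G) t).
apply: (is_derive_eq (is_deriveZ _ h1)).
have aux (a b c : R) : t != 0 -> a * (c^-1 * b) = 2^-1 * (t * b * (2 * a * c^-1)) / t.
  move=> tN; have -> : 2^-1 * (t * b * (2 * a * c^-1)) = a * (c^-1 * b) * t by lra.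
  by rewrite mulfK.
rewrite -matching_densityE ?ltW // /matching_density invfM invf_div.
by apply: aux; rewrite gt_eqF.
Qed.
End Pressure.

Section PressureDist.
Variables (R : realType) (G H : sgraph) (D : nat).
Hypothesis degG : forall x : G, (#|[set y | sadj x y]| <= D)%N.
Hypothesis degH : forall x : H, (#|[set y | sadj x y]| <= D)%N.

(** The derivative of the difference has a factor [1 / s], so the mean value theorem is applied only
    beyond [delta]. Up to [delta] both pressures lie between 0 and [delta * D%:R]. *)
Lemma pressure_dist (T delta e t : R) : 0 < delta -> 0 <= e ->
  (forall s, 0 <= s <= T -> `|unmatched G s - unmatched H s| <= e) -> 0 <= t <= T ->
  `|pressure G t - pressure H t| <= delta * D%:R + T * (e / delta).
Proof.
move=> d0 e0 close /andP[t0 tT]; have T0 := le_trans t0 tT.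
have small (s : R) : 0 <= s <= delta -> `|pressure G s - pressure H s| <= delta * D%:R.
  move=> /andP[s0 sd]; have sD : s * D%:R <= delta * D%:R by rewrite ler_wpM2r.
  have := pressure_bound degG s0; have := pressure_bound degH s0.
  move: (pressure G s) (pressure H s) (s * _) (delta * _) sD => a b c f cf.
  by move=> /andP[? ?] /andP[? ?]; rewrite ler_norml; lra.
have Te0 : 0 <= T * (e / delta) by rewrite !mulr_ge0 // invr_ge0 ltW.
have [td|dt] := leP t delta.
  by rewrite (le_trans (small t _)) ?t0 ?td // lerDl.
have gt0 (s : R) : s \in `]delta, t[ -> 0 < s by rewrite in_itv /= => /andP[/(lt_trans d0)].
have der (s : R) : 0 < s -> is_derive s 1 (pressure G - pressure H)
    (2^-1 * (unmatched H s - unmatched G s) / s).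
  move=> s0; apply: (is_derive_eq (is_deriveB (is_derive_pressure G s0) (is_derive_pressure H s0))).
  by move: (s^-1) (unmatched G s) (unmatched H s) => a b c; lra.
have [|c] := MVT_segment (ltW dt) (fun s hs => der s (gt0 s hs)).
  apply: derivable_within_continuous => s; rewrite in_itv /= => /andP[/(lt_le_trans d0) s0 _].
  by have := der s s0 => -[].
rewrite in_itv /= => /andP[dc ct] hc.
have c0 := lt_le_trans d0 dc.
have hb : `|pressure G t - pressure H t - (pressure G delta - pressure H delta)| <= T * (e / delta).
  have -> : pressure G t - pressure H t - (pressure G delta - pressure H delta) =
      2^-1 * (unmatched H c - unmatched G c) / c * (t - delta) by rewrite -hc.
  rewrite normrM mulrC (ger0_norm (_ : 0 <= t - delta)) ?subr_ge0 ?(ltW dt) //.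
  rewrite ler_pM ?subr_ge0 ?(ltW dt) //; first by lra.
  rewrite normrM ler_pM ?normr_ge0 //; last first.
    by rewrite gtr0_norm ?invr_gt0 // lef_pV2.
  have := close c _; rewrite (ltW c0) (le_trans ct tT) distrC => /(_ isT).
  rewrite normrM (ger0_norm (_ : 0 <= 2^-1)) //.
  by move: (normr_ge0 (unmatched H c - unmatched G c)); move: `|_| => a; lra.
have hs := small delta _; rewrite lexx (ltW d0) in hs; have {hs} := hs isT.
move: (pressure G t - _) (pressure G delta - _) (T * _) (delta * _) hb => a b c' f.
rewrite !ler_norml => /andP[? ?] /andP[? ?]; lra.
Qed.
End PressureDist.

Section Closeness.
Local Open Scope classical_set_scope.
Variable R : realType.

Lemma near_forall_finite (I : finType) (P : I -> nat -> Prop) :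
  (forall i, \forall n \near \oo, P i n) -> \forall n \near \oo, forall i, P i n.
Proof. exact: filter_forall. Qed.

(** The exponent is a successor because ball frequencies are controlled at positive radii only. *)
Lemma exists_expr_lt (a e : R) : 0 <= a < 1 -> 0 < e -> exists r : nat, a ^+ r.+1 < e.
Proof.
move=> /andP[a0 a1] e0.
have h : (@GRing.exp R a) n @[n --> \oo] --> (0 : R).
  by apply: cvg_expr; rewrite ger0_norm.
have /cvgrPdist_lt/(_ e e0)[N _ hN] := h.
exists N; have := hN N.+1 (leqnSn N).
by rewrite /= sub0r normrN ger0_norm // exprn_ge0.
Qed.

Lemma mul_div_add1_le (x e : R) : 0 <= x -> 0 <= e -> x * (e / (x + 1)) <= e.
Proof. by move=> x0 e0; rewrite mulrA ler_pdivrMr ?ltr_wpDl //; nra. Qed.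

(** The limit is any family of numbers, which covers convergent sequences both with and without a
    given random rooted graph. *)
Definition frequencies_cvg (Gs : nat -> sgraph) (l : rooted_sgraph -> nat -> R) :=
  forall a r, (0 < r)%N -> ball_freq R (Gs i) a r @[i --> \oo] --> l a r.

Lemma close_of_frequencies (Gs Hs : nat -> sgraph) l (T e : R) :
  bounded_degree Gs -> bounded_degree Hs ->
  frequencies_cvg Gs l -> frequencies_cvg Hs l -> 0 <= T -> 0 < e ->
  \forall N \near \oo, forall i j t, (N <= i)%N -> (N <= j)%N -> 0 <= t <= T ->
    `|unmatched (Gs i) t - unmatched (Hs j) t| <= e /\
    `|pressure (Gs i) t - pressure (Hs j) t| <= e.
Proof.
move=> [DG degG] [DH degH] cvG cvH T0 e0.
pose D := maxn DG DH.
have {}degG i x : (#|[set y : Gs i | sadj x y]%SET| <= D)%N.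
  by rewrite (leq_trans (degG i x)) // leq_maxl.
have {}degH i x : (#|[set y : Hs i | sadj x y]%SET| <= D)%N.
  by rewrite (leq_trans (degH i x)) // leq_maxr.
(* The two terms of [pressure_dist] are to be at most [e / 2] each: [delta] settles the first and
   the second entry of the minimum [e1] the other. Adding 1 keeps the denominators positive. *)
pose delta := e / 2 / (D%:R + 1).
have D1 : 0 < D%:R + 1 :> R by rewrite ltr_wpDl.
have d0 : 0 < delta by rewrite !divr_gt0.
pose e1 := Num.min e (e / 2 / (T + 1) * delta).
have T1 : 0 < T + 1 by rewrite ltr_wpDl.
have e10 : 0 < e1 by rewrite lt_min e0 mulr_gt0 // !divr_gt0.
have TD : 0 <= T * D%:R by rewrite mulr_ge0.
(* Half of [e1] goes to the two truncation errors, through the radius, and half to the frequencies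
   of the finitely many codes, through [e2]. *)
have [r hr] : exists r : nat, decay D T ^+ r.+1 < e1 / 4 / (T * D%:R + 1).
  by apply: exists_expr_lt; rewrite ?decay_bound // !divr_gt0 // ltr_wpDl.
pose C : finType := ball_code (D.+1 ^ r.+1).
pose e2 := e1 / 4 / (#|C|%:R + 1).
have C1 : 0 < #|C|%:R + 1 :> R by rewrite ltr_wpDl.
have e20 : 0 < e2 by rewrite !divr_gt0.
have fG : \forall N \near \oo, forall c : C, forall i, (N <= i)%N ->
    `|l (code_graph c) r.+1 - ball_freq R (Gs i) (code_graph c) r.+1| < e2.
  apply: near_forall_finite => c.
  have /cvgrPdist_lt/(_ e2 e20)[N _ hN] := cvG (code_graph c) r.+1 isT.
  by exists N => // n /= Nn i ni; apply: hN => /=; exact: leq_trans ni.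
have fH : \forall N \near \oo, forall c : C, forall i, (N <= i)%N ->
    `|l (code_graph c) r.+1 - ball_freq R (Hs i) (code_graph c) r.+1| < e2.
  apply: near_forall_finite => c.
  have /cvgrPdist_lt/(_ e2 e20)[N _ hN] := cvH (code_graph c) r.+1 isT.
  by exists N => // n /= Nn i ni; apply: hN => /=; exact: leq_trans ni.
apply: filterS2 fG fH => N hG hH i j t Ni Nj tT.
have uclose s : 0 <= s <= T -> `|unmatched (Gs i) s - unmatched (Hs j) s| <= e1.
  move=> sT; apply: le_trans (unmatched_dist r.+1 sT (degG i) (degH j)) _.
  have b1 : 2 * (T * D%:R * decay D T ^+ r.+1) <= e1 / 2.
    have : T * D%:R * decay D T ^+ r.+1 <= T * D%:R * (e1 / 4 / (T * D%:R + 1)).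
      by rewrite ler_wpM2l // ltW.
    have := mul_div_add1_le TD (ltW (divr_gt0 e10 (ltr0n R 4))).
    move: (T * D%:R * _) (T * D%:R * _) => a b; lra.
  have b2 : \sum_(c : C) `|ball_freq R (Gs i) (code_graph c) r.+1 -
       ball_freq R (Hs j) (code_graph c) r.+1| <= e1 / 2.
    apply: (@le_trans _ _ (\sum_(c : C) (2 * e2))).
      apply: ler_sum => c _; have := hG c i Ni; have := hH c j Nj.
      move: (l _ _) (ball_freq _ _ _ _) (ball_freq _ _ _ _) => a b f.
      by rewrite !ltr_norml ler_norml; lra.
    have := mul_div_add1_le (ler0n R #|C|) (ltW (divr_gt0 e10 (ltr0n R 4))).
    rewrite sumr_const -[X in _ -> X <= _]mulr_natr -/e2.
    by clearbody e2 => {hG hH e20}; move: e2 (#|C|%:R) => a b; lra.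
  move: b1 b2; move: (2 * _) (\sum_(c : _) _) => a b; lra.
split; first by apply: le_trans (uclose t tT) _; rewrite /e1 ge_min lexx.
apply: le_trans (pressure_dist (degG i) (degH j) d0 (ltW e10) uclose tT) _.
have h1 : D%:R * delta <= e / 2 by rewrite mul_div_add1_le // ltW // divr_gt0.
have h2 : T * (e1 / delta) <= e / 2.
  apply: (@le_trans _ _ (T * (e / 2 / (T + 1)))).
    by rewrite ler_wpM2l // ler_pdivrMr // /e1 ge_min lexx orbT.
  by rewrite mul_div_add1_le // ltW // divr_gt0.
move: h1 h2; rewrite [D%:R * _]mulrC; move: (delta * _) (T * _) => a b; lra.
Qed.
End Closeness.

(** * Entropy functions near density one *)

Section Entropy.
Local Open Scope classical_set_scope.
Variables (R : realType) (G : sgraph).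
Implicit Types (s t q : R).

Lemma max_matching_density_perfect :
  (exists S, @perfect_matching G S) -> max_matching_density R G = 1.
Proof.
move=> [S /andP[mS /eqP cS]]; rewrite /max_matching_density.
have -> : (2 * matching_number G)%N = #|G|; last by rewrite divff // gt_eqF // card_gt0R.
apply/eqP; rewrite eqn_leq; apply/andP; split.
  rewrite mulnC -leq_divRL //; apply/bigmax_leqP => m mm.
  by rewrite leq_divRL // mulnC matching_card_le.
rewrite -cardsT -cS card_cover_matching // leq_mul2l /=.
exact: (@leq_bigmax_cond _ (@matching G) (fun m => #|m|)).
Qed.

Lemma entropy_lt1 q : (exists S, @perfect_matching G S) -> q < 1 ->
  entropy G q = entropy_activity G (activity G q).
Proof. by move=> h q1; rewrite /entropy max_matching_density_perfect // q1. Qed.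

Lemma entropy_activityE t : 0 < t ->
  entropy_activity G t = pressure G t - 2^-1 * (1 - unmatched G t) * ln t.
Proof.
by move=> t0; rewrite /entropy_activity gt_eqF // matching_densityE // ltW.
Qed.

Lemma matching_density0 : matching_density G (0 : R) = 0.
Proof. by rewrite /matching_density mul0r mul0r. Qed.

(** By the intermediate value theorem on [[0, T]] the set behind [activity] is nonempty, so [get]
    returns a genuine solution; [0 < q] keeps it away from 0. *)
Lemma activityP T q : 0 <= T -> 0 < q -> q <= 1 - unmatched G T ->
  0 < activity G q /\ unmatched G (activity G q) = 1 - q.
Proof.
move=> T0 q0 qT.
have [c + hc] : exists2 c, c \in `[0, T]%R & matching_density G c = q.
  apply: (@IVT _ (@matching_density R G) 0 T q) => //; last first.
    by rewrite matching_density0 matching_densityE // ge_min le_max (ltW q0) qT orbT.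
  apply: derivable_within_continuous => s; rewrite in_itv /= => /andP[s0 _].
  rewrite /matching_density; apply: derivableM.
    by apply: derivableM => //; exact: derivable_horner.
  apply: derivableV; last by apply: derivableM => //; exact: derivable_horner.
  by rewrite mulf_neq0 // gt_eqF ?divr_gt0 ?card_gt0R ?matching_gen_gt0.
rewrite in_itv /= => /andP[c0 _].
have [a0 ha] : 0 <= activity G q /\ matching_density G (activity G q) = q.
  by apply: (@getPex _ [set t : R | 0 <= t /\ matching_density G t = q]); exists c.
split; last by move: ha; rewrite matching_densityE //; move: (unmatched G _) => u; lra.
by rewrite lt_neqAle a0 andbT; apply: contraTneq q0 => a; rewrite -ha -a matching_density0 ltxx.
Qed.

Lemma perfect_matching_card (S : {set {set G}}) :
  perfect_matching S -> #|S| = #|G|./2 /\ #|G| = (2 * #|G|./2)%N.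
Proof.
move=> /andP[mS /eqP cS]; have := card_cover_matching mS.
by rewrite cS cardsT => ->; rewrite mul2n doubleK -mul2n.
Qed.

Lemma nb_perfect_matchings_sum (c : R) :
  \sum_(m : {set {set G}} | perfect_matching m) c = (nb_perfect_matchings G)%:R * c.
Proof.
rewrite sumr_const -[LHS]mulr_natl; congr (_%:R * _).
by apply: eq_card => m; rewrite inE.
Qed.

Lemma matching_sum_ge_perfect t : 0 <= t ->
  (nb_perfect_matchings G)%:R * t ^+ #|G|./2 <= matching_sum t (@finset.set0 G).
Proof.
move=> t0; rewrite -nb_perfect_matchings_sum matching_sum0.
rewrite [leRHS](bigID (@perfect_matching G)) /= -[leLHS]addr0 lerD ?sumr_ge0 //; last first.
  by move=> m _; rewrite exprn_ge0.
rewrite (eq_bigl (fun m : {set {set G}} => matching m && perfect_matching m)); last first.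
  by move=> m; rewrite /perfect_matching; case: matching.
by apply: ler_sum => m /andP[_ /perfect_matching_card[->]].
Qed.

(** A matching that is not perfect has fewer than [#|G|./2] edges, so its weight is at most
    [t ^+ #|G|./2 / t]; [matching_sum 1 set0] counts all matchings. *)
Lemma matching_sum_le_perfect t : (exists S, @perfect_matching G S) -> 1 <= t ->
  matching_sum t (@finset.set0 G) <=
  t ^+ #|G|./2 * ((nb_perfect_matchings G)%:R + matching_sum 1 (@finset.set0 G) / t).
Proof.
move=> [S /perfect_matching_card[_ even]] t1; have t0 : 0 < t := lt_le_trans ltr01 t1.
rewrite mulrDr [t ^+ _ * _%:R]mulrC -nb_perfect_matchings_sum !matching_sum0.
rewrite [leLHS](bigID (@perfect_matching G)) /=; apply: lerD.
  rewrite (eq_bigl (@perfect_matching G)); last first.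
    by move=> m; rewrite /perfect_matching; case: matching.
  by apply: ler_sum => m /perfect_matching_card[->].
rewrite mulr_suml mulr_sumr [leRHS](bigID (@perfect_matching G)) /= -[leLHS]add0r.
apply: lerD.
  by apply: sumr_ge0 => m _; rewrite mulr_ge0 ?exprn_ge0 ?divr_ge0 ?ltW.
apply: ler_sum => m /andP[mm pm]; rewrite expr1n mulrA mulr1 ler_pdivlMr // -exprSr.
rewrite ler_weXn2l // ltnNge; apply: contra pm => h.
rewrite /perfect_matching mm /= eqEcard subsetT /= card_cover_matching // cardsT.
by rewrite even leq_mul2l.
Qed.

Definition perfect_entropy : R := ln (nb_perfect_matchings G)%:R / #|G|%:R.

(** When [G] has a perfect matching, this tends to [perfect_entropy] as [t] grows; its derivative in
    [ln t] is [- unmatched G t / 2]. *)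
Definition reduced_pressure t : R := pressure G t - 2^-1 * ln t.

Lemma ln_scaled_perfect (S : {set {set G}}) t x : perfect_matching S -> 0 < t -> 0 < x ->
  ln (x * t ^+ #|G|./2) / #|G|%:R = ln x / #|G|%:R + 2^-1 * ln t.
Proof.
move=> /perfect_matching_card[_ even] t0 x0.
rewrite lnM ?posrE ?exprn_gt0 // lnXn // mulrDl; congr (_ + _).
have n0 : #|G|./2%:R != 0 :> R.
  by have h := card_gt0R R G; rewrite even natrM pmulr_rgt0 // in h; rewrite lt0r_neq0.
have GE : #|G|%:R = 2 * #|G|./2%:R :> R by rewrite {1}even natrM.
by rewrite GE invfM -[ln t *+ _]mulr_natr mulrACA divff // mulr1 mulrC.
Qed.

Lemma nb_perfect_matchings_ge1 :
  (exists S, @perfect_matching G S) -> 1 <= (nb_perfect_matchings G)%:R :> R.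
Proof. by move=> [S pS]; rewrite ler1n; apply/card_gt0P; exists S; rewrite inE. Qed.

Lemma perfect_entropy_le t : (exists S, @perfect_matching G S) -> 0 < t ->
  perfect_entropy <= reduced_pressure t.
Proof.
move=> pG t0; have pm1 := nb_perfect_matchings_ge1 pG; have [S pS] := pG.
have pm0 := lt_le_trans ltr01 pm1.
rewrite /reduced_pressure lerBrDr -(ln_scaled_perfect pS) // /pressure.
rewrite ler_wpM2r ?invr_ge0 // horner_matching_gen.
rewrite ler_ln ?posrE ?matching_sum_gt0 ?mulr_gt0 ?exprn_gt0 //; last exact: ltW.
by rewrite matching_sum_ge_perfect // ltW.
Qed.

(** The error term depends on [G]: it identifies the limit at infinity, while the uniform rate comes
    from [unmatched_le]. *)
Lemma reduced_pressure_le t : (exists S, @perfect_matching G S) -> 1 <= t ->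
  reduced_pressure t <= perfect_entropy + matching_sum 1 (@finset.set0 G) / t.
Proof.
move=> pG t1; have pm1 := nb_perfect_matchings_ge1 pG; have [S pS] := pG.
have pm0 := lt_le_trans ltr01 pm1; have t0 := lt_le_trans ltr01 t1.
set y := _ / t; have y0 : 0 <= y by rewrite divr_ge0 ?ltW ?matching_sum_gt0.
rewrite /reduced_pressure lerBlDr.
apply: (@le_trans _ _ (ln (((nb_perfect_matchings G)%:R + y) * t ^+ #|G|./2) / #|G|%:R)).
  rewrite ler_wpM2r ?invr_ge0 // horner_matching_gen.
  rewrite ler_ln ?posrE ?matching_sum_gt0 ?mulr_gt0 ?exprn_gt0 ?ltr_wpDr //; last exact: ltW.
  by rewrite mulrC matching_sum_le_perfect.
rewrite (ln_scaled_perfect pS) ?ltr_wpDr // lerD2r /perfect_entropy.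
have G1 : 1 <= #|G|%:R :> R by rewrite ler1n svertex_gt0.
rewrite ler_pdivrMr ?card_gt0R // mulrDl divfK ?lt0r_neq0 ?card_gt0R //.
have -> : (nb_perfect_matchings G)%:R + y =
    (nb_perfect_matchings G)%:R * (1 + y / (nb_perfect_matchings G)%:R).
  by rewrite mulrDr mulr1 mulrCA divff ?mulr1 // gt_eqF.
have yp : 0 <= y / (nb_perfect_matchings G)%:R by rewrite divr_ge0.
rewrite lnM ?posrE ?ltr_wpDr // lerD2l (le_trans (le_ln1Dx _)) //.
  by rewrite (lt_le_trans _ yp).
rewrite ler_pdivrMr // -mulrA -[leLHS]mulr1 ler_wpM2l //.
by rewrite mulr_ege1.
Qed.
End Entropy.

(** * Uniform rate of convergence at large activity *)

Section TransitiveEntropy.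
Local Open Scope classical_set_scope.
Variables (R : realType) (G : sgraph) (d : nat).
Hypothesis d1 : (1 <= d)%N.
Hypothesis vt : vertex_transitive G.
Hypothesis bip : bipartite G.
Hypothesis reg : regular_graph G d.
Implicit Types (s t q : R).

Lemma unmatched_le t : 0 < t -> unmatched G t <= (Num.sqrt t)^-1.
Proof.
move=> t0; have u0 := unmatched_ge0 G (ltW t0).
have h := unmatched_sqr_le vt bip reg (ltW t0).
have h2 : (unmatched G t * Num.sqrt t) ^+ 2 <= 1.
  rewrite exprMn sqr_sqrtr ?(ltW t0) // (le_trans _ h) // ler_wpM2l ?sqr_ge0 //.
  by rewrite -[leLHS]mulr1 ler_wpM2l ?(ltW t0) // ler1n.
rewrite -[leRHS]mul1r ler_pdivlMr ?sqrtr_gt0 //.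
by rewrite -(@expr_le1 _ 2) // mulr_ge0 ?sqrtr_ge0.
Qed.

(* The monomer density tends to [0] as [t] grows, so no proportion of the
   vertices is missed by all the matchings. *)
Lemma exists_perfect_matching : exists S, @perfect_matching G S.
Proof.
apply: contrapT => no_pm.
have small (m : {set {set G}}) : matching m -> (2 * #|m| < #|G|)%N.
  move=> mm; rewrite ltn_neqAle matching_card_le // andbT.
  apply/eqP => mG; apply: no_pm; exists m.
  by rewrite /perfect_matching mm /= eqEcard subsetT cardsT card_cover_matching // mG leqnn.
have G0 := card_gt0R R G.
(* If every matching misses a vertex then [#|G| * unmatched G t >= 1], which contradicts
   [unmatched G t ^+ 2 * t <= 1] once [t] exceeds [#|G| ^+ 2]. *)
pose t : R := #|G|%:R ^+ 2 + 1.
have t0 : 0 < t by rewrite ltr_wpDl // exprn_ge0.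
have h1 : 1 <= #|G|%:R * unmatched G t.
  have Z0 : 0 < matching_sum t (@finset.set0 G) by rewrite matching_sum_gt0 // ltW.
  have mu : 2 * mean_matching_size G t <= #|G|%:R - 1.
    rewrite /mean_matching_size mulrA ler_pdivrMr // matching_sum0 !mulr_sumr.
    apply: ler_sum => m mm; rewrite mulrA ler_wpM2r ?exprn_ge0 ?(ltW t0) //.
    by rewrite lerBrDr -natrM natr1 ler_nat small.
  have := mean_matching_sizeE G (ltW t0) => /(congr1 (fun x => x * #|G|%:R)).
  rewrite -[RHS]mulrA divfK ?lt0r_neq0 //.
  move: mu; move: (mean_matching_size G t) (unmatched G t) (#|G|%:R) => a b c; lra.
have h2 : unmatched G t ^+ 2 * t <= 1.
  apply: le_trans (unmatched_sqr_le vt bip reg (ltW t0)).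
  by rewrite ler_wpM2l ?sqr_ge0 // -[leLHS]mulr1 ler_wpM2l ?(ltW t0) // ler1n.
move: h1 h2 (unmatched_ge0 G (ltW t0)).
move: (unmatched G t) => u; rewrite /t; move: (#|G|%:R) G0 => c c0 h1 h2 u0.
have h3 : 1 <= (c * u) ^+ 2 by rewrite exprn_ege1.
have u1 : 0 < u.
  by rewrite lt_neqAle u0 andbT; apply: contraTneq h1 => <-; rewrite mulr0 -ltNge ltr01.
have : 0 < u ^+ 2 by rewrite exprn_gt0.
move: h2 h3; rewrite exprMn; lra.
Qed.

(** By convexity the loss from [s] to [4 * s] is at most [unmatched G s * ln 2]. The ratio 4 halves
    the bound [1 / sqrt s] at each step. *)
Lemma reduced_pressure_step s : 0 < s ->
  reduced_pressure G s <= reduced_pressure G (4 * s) + (Num.sqrt s)^-1.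
Proof.
move=> s0; have s40 : 0 < 4 * s by rewrite mulr_gt0.
have h := pressure_convex G s40 s0.
have ln4 : ln 4 = 2 * ln 2 :> R.
  by rewrite (_ : 4 = 2 ^+ 2 :> R) ?lnXn ?mulr_natl // -natrX.
have ln2 : ln 2 <= 1 :> R by have := @le_ln1Dx R 1; apply; lra.
have ln20 : 0 <= ln 2 :> R by rewrite ln_ge0 // ler1n.
have u := unmatched_le s0; have u0 := unmatched_ge0 G (ltW s0).
move: h; rewrite /reduced_pressure lnM ?posrE // addrK ln4.
have h2 : unmatched G s * ln 2 <= (Num.sqrt s)^-1.
  by rewrite (le_trans _ u) // -[leRHS]mulr1 ler_wpM2l.
move: h2; move: (pressure G s) (pressure G _) (unmatched G s) (ln 2) (ln s) (_^-1).
by move=> a b c e f g; lra.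
Qed.

(** The losses form a geometric series of ratio [1 / 2], whence the constant 2. *)
Lemma reduced_pressure_iter k t : 0 < t ->
  reduced_pressure G t <= reduced_pressure G (4 ^+ k * t) + 2 / Num.sqrt t.
Proof.
elim: k t => [|k IHk] t t0; first by rewrite expr0 mul1r lerDl divr_ge0 ?sqrtr_ge0.
have h := IHk (4 * t) (mulr_gt0 (ltr0n R 4) t0).
have := reduced_pressure_step t0.
move: h; rewrite sqrtrM // (_ : Num.sqrt 4 = 2); last first.
  by rewrite (_ : 4 = 2 ^+ 2 :> R) ?sqrtr_sqr ?ger0_norm // -natrX.
rewrite mulrA -exprSr invfM mulrA divff // mul1r.
move: (reduced_pressure _ _) (reduced_pressure _ _) (reduced_pressure _ _) (_^-1).
by move=> a b c e; lra.
Qed.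

Lemma reduced_pressure_near t : 0 < t ->
  perfect_entropy R G <= reduced_pressure G t <= perfect_entropy R G + 2 / Num.sqrt t.
Proof.
move=> t0; rewrite (perfect_entropy_le exists_perfect_matching t0) /=.
apply/ler_addgt0Pr => e e0.
pose z := matching_sum (1 : R) (@finset.set0 G).
have z0 : 0 < z by rewrite matching_sum_gt0.
(* A [k] for which the error of [reduced_pressure_le] at [4 ^+ k * t] is at most [e]; it may depend
   on [G] since the bound on the iterated loss does not involve [k]. *)
pose k := Num.bound ((1 + z / e) / t).
have x0 : 0 <= (1 + z / e) / t by rewrite divr_ge0 ?ltW // addr_gt0 // divr_gt0.
have kx : 1 + z / e <= 4 ^+ k * t.
  rewrite -ler_pdivrMr // (le_trans (ltW (archi_boundP x0))) // -natrX ler_nat ltnW //.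
  exact: ltn_expl.
have ze : 0 < z / e by rewrite divr_gt0.
have t1 : 1 <= 4 ^+ k * t by rewrite (le_trans _ kx) // lerDl ltW.
apply: le_trans (reduced_pressure_iter k t0) _.
have := reduced_pressure_le exists_perfect_matching t1; rewrite -/z.
have : z / (4 ^+ k * t) <= e.
  rewrite ler_pdivrMr ?(lt_le_trans ltr01 t1) // mulrC -ler_pdivrMr //.
  by rewrite (le_trans _ kx) // lerDr.
move: (reduced_pressure _ _) (perfect_entropy R G) (z / _) (2 / _) => a b c f {kx t1 x0 ze z0}; lra.
Qed.

(** The entropy is [reduced_pressure] plus [unmatched G t * ln t / 2]. With [y] the fourth root of
    [t] and [ln t <= 4 * (y - 1)], the two errors [2 / y ^+ 2] and [2 * (y - 1) / y ^+ 2] add up to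
    exactly [2 / y]. *)
Lemma entropy_activity_near t : 1 <= t ->
  `|entropy_activity G t - perfect_entropy R G| <= 2 / Num.sqrt (Num.sqrt t).
Proof.
move=> t1; have t0 := lt_le_trans ltr01 t1.
rewrite entropy_activityE //.
have /andP[l1 l2] := reduced_pressure_near t0.
have u := unmatched_le t0; have u0 := unmatched_ge0 G (ltW t0).
set y := Num.sqrt (Num.sqrt t).
have y1 : 1 <= y by rewrite -[1]sqrtr1 ler_wsqrtr // -[leLHS]sqrtr1 ler_wsqrtr.
have y0 := lt_le_trans ltr01 y1.
have y2 : Num.sqrt t = y ^+ 2 by rewrite sqr_sqrtr ?sqrtr_ge0.
have y4 : t = y ^+ 4 by rewrite (exprM y 2 2) -y2 sqr_sqrtr // ltW.
have lnt0 : 0 <= ln t by rewrite ln_ge0.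
have lnt : ln t <= 4 * (y - 1).
  rewrite y4 lnXn // -[leLHS]mulr_natl ler_wpM2l //.
  by have := @le_ln1Dx R (y - 1); rewrite [1 + _]addrC subrK; apply; rewrite ltrBrDr addNr.
have ul : unmatched G t * ln t <= (y ^+ 2)^-1 * (4 * (y - 1)).
  by rewrite -y2 ler_pM.
have yE : 2 / y = 2 * (y ^+ 2)^-1 * y by rewrite expr2 invfM -!mulrA mulVf ?mulr1 // gt_eqF.
have ul0 : 0 <= unmatched G t * ln t by rewrite mulr_ge0.
move: l1 l2; rewrite yE /reduced_pressure y2.
move: ul ul0; move: (pressure G t) (perfect_entropy R G) (unmatched G t) (ln t) (y ^+ 2)^-1.
by move=> a b c f g ? ? ? ?; rewrite ler_norml; lra.
Qed.
End TransitiveEntropy.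

(** * Limits along convergent sequences *)

Section Limits.
Local Open Scope classical_set_scope.
Variable R : realType.

(** A density near 1 forces a large activity, because [unmatched_ge] gives
    [unmatched G t >= 1 / (1 + t * d)]. Thus [delta] depends on [d] and [e] alone. *)
Lemma entropy_near_one (d : nat) (e : R) : (1 <= d)%N -> 0 < e ->
  exists2 delta, 0 < delta < 1 & forall G : sgraph,
    vertex_transitive G -> bipartite G -> regular_graph G d ->
    forall q, 1 - delta < q < 1 -> `|entropy G q - perfect_entropy R G| <= e.
Proof.
move=> d1 e0; pose K := Num.max 1 ((2 / e) ^+ 4).
have K1 : 1 <= K by rewrite /K le_max lexx.
have Kd : 0 < K * d%:R by rewrite mulr_gt0 ?(lt_le_trans ltr01 K1) // ltr0n.
exists (1 + K * d%:R)^-1.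
  by rewrite invr_gt0 ltr_pwDl ?ltW // invf_lt1 ?ltrDl ?ltr_pwDl // ltW.
move=> G vt bip reg q /andP[qd q1].
have pG := exists_perfect_matching R d1 vt bip reg.
have q10 : 0 < 1 - q by rewrite subr_gt0.
have qd' : (1 - q) * (1 + K * d%:R) < 1.
  rewrite -ltr_pdivlMr ?ltr_pwDl ?(ltW Kd) // mul1r.
  by move: qd; move: (_^-1) => a; lra.
have q0 : 0 < q.
  have : (1 - q) * 1 <= (1 - q) * (1 + K * d%:R).
    by rewrite ler_wpM2l ?(ltW q10) // lerDl ltW.
  by move: qd'; move: (_ * (1 + _)) => a; lra.
have T0 : 0 < (1 - q)^-1 ^+ 2 by rewrite exprn_gt0 // invr_gt0.
(* The activity [(1 - q)^-1 ^+ 2] is chosen so that [unmatched_le] gives exactly [1 - q]. *)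
have qT : q <= 1 - unmatched G ((1 - q)^-1 ^+ 2).
  have := unmatched_le d1 vt bip reg T0.
  rewrite sqrtr_sqr ger0_norm ?invr_ge0 ?(ltW q10) // invrK.
  by move: (unmatched G _) => u; lra.
have [a0 ua] := activityP (ltW T0) q0 qT.
rewrite entropy_lt1 //; move: a0 ua; move: (activity G q) => t t0 ut.
have tK : K <= t.
  rewrite leNgt; apply/negP => tK.
  have degG x : (#|[set y : G | sadj x y]%SET| <= d)%N by rewrite reg.
  have := unmatched_ge degG (ltW t0); rewrite ut leNgt => /negP; apply.
  rewrite mulrC (le_lt_trans _ qd') // ler_wpM2l ?(ltW q10) // lerD2l ler_wpM2r //.
  exact: ltW.
apply: le_trans (entropy_activity_near d1 vt bip reg (le_trans K1 tK)) _.
have e2 : 0 < 2 / e by rewrite divr_gt0.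
have : 2 / e <= Num.sqrt (Num.sqrt t).
  have -> : 2 / e = Num.sqrt (Num.sqrt ((2 / e) ^+ 4)).
    by rewrite (exprM _ 2 2) sqrtr_sqr (ger0_norm (sqr_ge0 _)) sqrtr_sqr ger0_norm // ltW.
  by rewrite !ler_wsqrtr // (le_trans _ tK) // /K le_max lexx orbT.
have s0 : 0 < Num.sqrt (Num.sqrt t) by rewrite !sqrtr_gt0.
by rewrite !ler_pdivrMr // mulrC.
Qed.

(** By [pressure_convex], the entropy at [q] minimizes [pressure G t - q / 2 * ln t] over [t > 0].
    Each minimum is compared with the other graph's function at the same point; the conditions at
    [T] keep both minimizers in [[0, T]]. *)
Lemma entropy_dist (G H : sgraph) (T q e : R) :
  (exists S, @perfect_matching G S) -> (exists S, @perfect_matching H S) ->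
  0 < T -> 0 < q < 1 -> q < 1 - unmatched G T -> q < 1 - unmatched H T ->
  (forall t, 0 <= t <= T -> `|pressure G t - pressure H t| <= e) ->
  `|entropy G q - entropy H q| <= e.
Proof.
move=> pG pH T0 /andP[q0 q1] qG qH close.
have [a0 ua] := activityP (ltW T0) q0 (ltW qG).
have [b0 ub] := activityP (ltW T0) q0 (ltW qH).
rewrite !entropy_lt1 //; move: a0 ua b0 ub.
move: (activity G q) (activity H q) => a b a0 ua b0 ub.
have aT : a <= T.
  rewrite leNgt; apply/negP => /ltW /(unmatched_nonincreasing G T0).
  by rewrite ua; move: qG; move: (unmatched G T) => u; lra.
have bT : b <= T.
  rewrite leNgt; apply/negP => /ltW /(unmatched_nonincreasing H T0).
  by rewrite ub; move: qH; move: (unmatched H T) => u; lra.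
rewrite !entropy_activityE // ua ub.
have := pressure_convex G b0 a0; have := pressure_convex H a0 b0; rewrite ua ub.
have := close a _; rewrite aT (ltW a0) => /(_ isT).
have := close b _; rewrite bT (ltW b0) => /(_ isT).
move: (pressure G a) (pressure G b) (pressure H a) (pressure H b) (ln a) (ln b).
move=> x y z w f g; rewrite !ler_norml => /andP[? ?] /andP[? ?] ? ?.
lra.
Qed.

Lemma cauchy_sequence_cvg (u : nat -> R) :
  (forall e, 0 < e -> exists N, forall i j, (N <= i)%N -> (N <= j)%N -> `|u i - u j| <= e) ->
  cvgn u.
Proof.
move=> h; apply/cauchy_cvgP; apply/cauchy_exP => e e0.
have [N hN] := h _ (divr_gt0 e0 (ltr0n R 2)).
exists (u N); exists N => // n /= Nn.
rewrite /ball /= (le_lt_trans (hN N n (leqnn N) Nn)) // ltr_pdivrMr //.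
by rewrite ltr_pMr // ltr1n.
Qed.

Lemma perfect_entropy_cauchy (d : nat) (Gs : nat -> sgraph)
    (l : rooted_sgraph -> nat -> R) (e : R) : (1 <= d)%N ->
  (forall i, vertex_transitive (Gs i)) -> (forall i, bipartite (Gs i)) ->
  (forall i, regular_graph (Gs i) d) -> frequencies_cvg Gs l -> 0 < e ->
  exists N, forall i j, (N <= i)%N -> (N <= j)%N ->
    `|perfect_entropy R (Gs i) - perfect_entropy R (Gs j)| <= e.
Proof.
move=> d1 vt bip reg cvG e0.
have bd : bounded_degree Gs by exists d => i x; rewrite reg.
have e4 : 0 < 4 / e by rewrite divr_gt0.
(* At this activity the gap between [reduced_pressure] and [perfect_entropy] is at most
   [2 / sqrt t = e / 2]. *)
pose t := (4 / e) ^+ 2; have t0 : 0 < t by rewrite exprn_gt0.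
have [N _ hN] := close_of_frequencies bd bd cvG cvG (ltW t0) (divr_gt0 e0 (ltr0n R 2)).
have st : 2 / Num.sqrt t = e / 2.
  by rewrite sqrtr_sqr ger0_norm ?ltW // invf_div; lra.
exists N => i j Ni Nj.
have [_] := hN N (leqnn N) i j t Ni Nj (introT andP (conj (ltW t0) (lexx t))).
have := reduced_pressure_near d1 (vt i) (bip i) (reg i) t0.
have := reduced_pressure_near d1 (vt j) (bip j) (reg j) t0.
rewrite st /reduced_pressure.
move: (perfect_entropy _ _) (perfect_entropy _ _) (pressure _ _) (pressure _ _) (ln t).
by move=> a b c f g; rewrite !ler_norml => /andP[? ?] /andP[? ?] /andP[? ?]; lra.
Qed.

Lemma entropy_cauchy (d : nat) (Gs Hs : nat -> sgraph)
    (l : rooted_sgraph -> nat -> R) (q e : R) : (1 <= d)%N ->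
  (forall i, vertex_transitive (Gs i)) -> (forall i, bipartite (Gs i)) ->
  (forall i, regular_graph (Gs i) d) ->
  bounded_degree Hs -> (forall i, exists S, @perfect_matching (Hs i) S) ->
  frequencies_cvg Gs l -> frequencies_cvg Hs l -> 0 < q < 1 -> 0 < e ->
  exists N, forall i j, (N <= i)%N -> (N <= j)%N ->
    `|entropy (Gs i) q - entropy (Hs j) q| <= e.
Proof.
move=> d1 vt bip reg bdH pH cvG cvH qq e0; have /andP[q0 q1] := qq.
have bd : bounded_degree Gs by exists d => i x; rewrite reg.
have q10 : 0 < 1 - q by rewrite subr_gt0.
have q4 : 0 < 4 / (1 - q) by rewrite divr_gt0.
(* This makes [unmatched (Gs i) T] at most [(1 - q) / 4]. Closeness within [(1 - q) / 4] carries a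
   bound below [1 - q] over to [Hs], whose graphs need not be transitive. *)
pose T := (4 / (1 - q)) ^+ 2; have T0 : 0 < T by rewrite exprn_gt0.
have e10 : 0 < Num.min e ((1 - q) / 4) by rewrite lt_min e0 divr_gt0.
have [N _ hN] := close_of_frequencies bd bdH cvG cvH (ltW T0) e10.
exists N => i j Ni Nj.
have uG : unmatched (Gs i) T <= (1 - q) / 4.
  have := unmatched_le d1 (vt i) (bip i) (reg i) T0.
  by rewrite sqrtr_sqr ger0_norm ?(ltW q4) // invf_div.
have [uGH _] := hN N (leqnn N) i j T Ni Nj (introT andP (conj (ltW T0) (lexx T))).
have {}uGH : `|unmatched (Gs i) T - unmatched (Hs j) T| <= (1 - q) / 4.
  by rewrite (le_trans uGH) // ge_min lexx orbT.
apply: (entropy_dist (exists_perfect_matching R d1 (vt i) (bip i) (reg i)) (pH j) T0 qq).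
- by move: uG; move: (unmatched _ _) => u; lra.
- move: uG uGH; move: (unmatched (Gs i) T) (unmatched (Hs j) T) => u v.
  by rewrite ler_norml => ? /andP[? ?]; lra.
move=> t tT; have [_ h] := hN N (leqnn N) i j t Ni Nj tT.
by rewrite (le_trans h) // ge_min lexx.
Qed.

(** The sequence [Gs] shows that the set behind [limit_entropy_lt1] is nonempty. The value chosen
    there is the limit along some other sequence [Hs], and [entropy_cauchy] compares the two. *)
Lemma cvg_entropy_limit (d : nat) (Gs : nat -> sgraph) (L : random_rgraph R) (q : R) :
  (1 <= d)%N -> (forall i, vertex_transitive (Gs i)) -> (forall i, bipartite (Gs i)) ->
  (forall i, regular_graph (Gs i) d) -> BS_converges_to Gs L -> 0 < q < 1 ->
  entropy (Gs i) q @[i --> \oo] --> limit_entropy_lt1 L q.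
Proof.
move=> d1 vt bip reg cvG qq.
have pG i := exists_perfect_matching R d1 (vt i) (bip i) (reg i).
have [Hs [cvH pH cvl]] : [set l : R | exists Hs : nat -> sgraph,
    [/\ BS_converges_to Hs L, forall i, exists S, @perfect_matching (Hs i) S
      & entropy (Hs i) q @[i --> \oo] --> l]] (limit_entropy_lt1 L q).
  apply: getPex; exists (limn (fun i => entropy (Gs i) q)); exists Gs; split=> //.
  apply: cauchy_sequence_cvg => e e0.
  exact: (entropy_cauchy d1 vt bip reg cvG.1 pG cvG.2 cvG.2).
apply/cvgrPdist_le => e e0; have e2 : 0 < e / 2 by rewrite divr_gt0.
have [N hN] := entropy_cauchy d1 vt bip reg cvH.1 pH cvG.2 cvH.2 qq e2.
have /cvgrPdist_le/(_ _ e2)[M _ hM] := cvl.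
exists N => // i /= Ni.
have := hN i _ Ni (leq_maxl N M); have := hM _ (leq_maxr N M) => /=.
move: (limit_entropy_lt1 L q) (entropy _ _) (entropy _ _) => a b c.
by rewrite !ler_norml => /andP[? ?] /andP[? ?]; lra.
Qed.

Lemma cvg_entropy_activity_one (d : nat) (G : sgraph) : (1 <= d)%N ->
  vertex_transitive G -> bipartite G -> regular_graph G d ->
  entropy_activity G (activity G q) @[q --> (1 : R)^'-] --> perfect_entropy R G.
Proof.
move=> d1 vt bip reg; have pG := exists_perfect_matching R d1 vt bip reg.
apply/cvgrPdist_le => e e0; have [delta /andP[d0 _] hd] := entropy_near_one d1 e0.
near=> q; have q1 : q < 1 by near: q; exact: nbhs_left_lt.
rewrite -entropy_lt1 // distrC; apply: hd => //; rewrite q1 andbT.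
by near: q; apply: nbhs_left_gt; rewrite ltrBlDr ltrDl.
Unshelve. all: by end_near.
Qed.

Lemma entropy_one (d : nat) (G : sgraph) : (1 <= d)%N ->
  vertex_transitive G -> bipartite G -> regular_graph G d ->
  entropy G (1 : R) = perfect_entropy R G.
Proof.
move=> d1 vt bip reg; have pG := exists_perfect_matching R d1 vt bip reg.
rewrite /entropy max_matching_density_perfect // ltxx.
exact: cvg_lim (cvg_entropy_activity_one d1 vt bip reg).
Qed.
End Limits.

Local Open Scope classical_set_scope.

Theorem theorem1p8 (R : realType) (d : nat) (hd : (1 <= d)%N)
    (Gs : nat -> sgraph)
    (hvt : forall i, vertex_transitive (Gs i))
    (hbip : forall i, bipartite (Gs i))
    (hreg : forall i, regular_graph (Gs i) d)
    (hBS : BS_convergent R Gs) :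
  (forall i, entropy (Gs i) (1 : R) =
     ln ((nb_perfect_matchings (Gs i))%:R : R) / #|Gs i|%:R) /\
  cvgn (fun i => entropy (Gs i) (1 : R)) /\
  (forall L : random_rgraph R, BS_converges_to Gs L ->
     limn (fun i => entropy (Gs i) (1 : R)) = limit_entropy L 1).
Proof.
have E i : entropy (Gs i) (1 : R) = perfect_entropy R (Gs i).
  exact: (entropy_one R hd (hvt i) (hbip i) (hreg i)).
have cvG : frequencies_cvg Gs (fun a r => limn (fun i => ball_freq R (Gs i) a r)).
  by move=> a r; exact: hBS.2.
have cvE : cvgn (fun i => perfect_entropy R (Gs i)).
  apply: cauchy_sequence_cvg => e.
  exact: (perfect_entropy_cauchy hd hvt hbip hreg cvG).
split=> //.
rewrite (_ : (fun i => entropy (Gs i) 1) = fun i => perfect_entropy R (Gs i)); last first.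
  exact/funext.
(* At density 1 [limit_entropy] is a left limit, so the goal becomes the interchange of [q] tending
   to 1 with [i] tending to infinity. *)
split=> // L cvL; rewrite /limit_entropy ltxx; apply/esym/cvg_lim => //.
apply/cvgrPdist_le => e e0; have e3 : 0 < e / 3 by rewrite divr_gt0.
have [delta /andP[d0 d1] hdelta] := entropy_near_one hd e3.
near=> q.
have q1 : q < 1 by near: q; exact: nbhs_left_lt.
have qd : 1 - delta < q by near: q; apply: nbhs_left_gt; rewrite ltrBlDr ltrDl.
have q0 : 0 < q by apply: lt_trans qd; rewrite subr_gt0.
(* As [delta] is uniform over the graphs, the index can be chosen after [q]; the three errors are
   each at most [e / 3]. *)
have /cvgrPdist_le/(_ _ e3)[N _ hN] :=
  cvg_entropy_limit hd hvt hbip hreg cvL (introT andP (conj q0 q1)).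
have /cvgrPdist_le/(_ _ e3)[M _ hM] := cvE.
have := hdelta _ (hvt (maxn N M)) (hbip _) (hreg _) q (introT andP (conj qd q1)).
have /= := hN _ (leq_maxl N M); have /= := hM _ (leq_maxr N M).
move: (limn _) (limit_entropy_lt1 L q) (entropy _ _) (perfect_entropy _ _) => a b c f.
by rewrite !ler_norml => /andP[? ?] /andP[? ?] /andP[? ?]; lra.
Unshelve. all: by end_near.
Qed.
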